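(* Let $s>0$ and let $\gamma_s^{(2)}(y)=\frac{1}{2\pi s}e^{-\|y\|_2^2/(2s)}$ denote the two-dimensional Gaussian density of variance $s$. Then, for every integer $j\ge0$, the marginalisation $U\mapsto\Pi_{\gamma_s^{(2)}}U$ defines a surjective map $$\Pi_{\gamma_s^{(2)}}:\left\{\widetilde U\in\mathcal{PC}_j:\ \Pi_{\gamma_s^{(2)}}\widetilde U\text{ is finite valued}\right\}\twoheadrightarrow\left\{U\in\mathcal{PC}_{j+1}:\ U\text{ is continuous at }0\right\}.$$ Moreover, every energy density in the domain is automatically continuous at $0$.
   Context: An energy density is a measurable function $U:[0,\infty)\to\mathbb{R}$ with $U(0)=0$. For a probability density $\sigma$ on $\mathbb{R}^m$, the marginalisation of $U$ by $\sigma$ is $\Pi_\sigma U(\rho)=\int_{\mathbb{R}^m}U(\rho\,\sigma(y))\,dy$, $\rho\ge0$; it is finite valued if this integral is a finite real number for every $\rho\ge0$. Pressure: if $U$ is convex, its pressure law is $P:[0,\infty)\to\mathbb{R}$, $P(0)=0$ and $P(\rho)=\rho\,U'_+(\rho)-U(\rho)$ for $\rho>0$, where $U'_+$ is the right derivative. Pressure classes: $\mathcal{PC}_0$ is the class of energy densities $U$ for which $\rho\mapsto U(\rho)/\rho$ is nondecreasing on $(0,\infty)$. For $c\ge1$ and $F:[0,\infty)\to\mathbb{R}$ put $\Delta_cF(\rho)=F(c\rho)-F(\rho)$. For an integer $k\ge1$, $\mathcal{PC}_k$ is the class of convex energy densities $U$ whose pressure law satisfies $\Delta_{c_1}\cdots\Delta_{c_k}P(\rho)\ge0$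 for all $\rho\ge0$ and all $c_1,\dots,c_k\ge1$. *)

(* Defs.v *)
From HB Require Import structures.
From mathcomp Require Import all_boot all_order all_algebra.
From mathcomp Require Import all_classical all_reals all_analysis.

Set Implicit Arguments.
Unset Strict Implicit.
Unset Printing Implicit Defensive.

Import Order.TTheory GRing.Theory Num.Theory.
Import numFieldNormedType.Exports.

Local Open Scope classical_set_scope.
Local Open Scope ring_scope.

(* A function [0, oo) -> R is represented by a function R -> R of which only
   the values on [0, oo) are relevant: every notion below depends only on these
   values, and two such functions are identified when they agree on [0, oo)
   (eq_nonneg). *)

Definition eq_nonneg (R : realType) (U V : R -> R) : Prop :=
  {in `[0, +oo[, U =1 V}.

Definition energy_density (R : realType) (U : R -> R) : Prop :=
  measurable_fun (`[0, +oo[%classic : set R) U /\ U 0 = 0.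

Definition continuous_at0 (R : realType) (U : R -> R) : Prop :=
  U @ within `[0, +oo[ (nbhs (0 : R)) --> U 0.

(* The ambient measure space (T, mu) is R^m with its Lebesgue measure. *)
Section marginalisation.
Context d (T : measurableType d) (R : realType).
Variable mu : {measure set T -> \bar R}.

Definition marginalisation_ereal (sigma : T -> R) (U : R -> R) (rho : R) :
    \bar R :=
  (\int[mu]_y (U (rho * sigma y))%:E)%E.

(* The integral is the difference of those of the positive and negative parts,
   with +oo - +oo = -oo: it is a finite number iff both parts have a finite
   integral. *)
Definition finite_valued (sigma : T -> R) (U : R -> R) : Prop :=
  forall rho, 0 <= rho -> marginalisation_ereal sigma U rho \is a fin_num.

Definition marginalisation (sigma : T -> R) (U : R -> R) (rho : R) : R :=
  fine (marginalisation_ereal sigma U rho).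

End marginalisation.

Definition lebesgue_measure2 (R : realType) :
    {measure set (measurableTypeR R * measurableTypeR R) -> \bar R} :=
  (@lebesgue_measure R \x @lebesgue_measure R)%E.

Definition gaussian2 (R : realType) (s : R) (y : R * R) : R :=
  (2 * pi * s)^-1 * expR (- (y.1 ^+ 2 + y.2 ^+ 2) / (2 * s)).

Definition right_derivative (R : realType) (U : R -> R) (rho : R) : R :=
  lim ((fun h => (U (rho + h) - U rho) / h) @ (0 : R)^'+).

Definition pressure (R : realType) (U : R -> R) (rho : R) : R :=
  if rho == 0 then 0 else rho * right_derivative U rho - U rho.

Definition Delta (R : realType) (c : R) (F : R -> R) (rho : R) : R :=
  F (c * rho) - F rho.

Definition iter_Delta (R : realType) (cs : seq R) (F : R -> R) : R -> R :=
  foldr (@Delta R) F cs.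

Definition pressure_class (R : realType) (k : nat) (U : R -> R) : Prop :=
  match k with
  | 0 => energy_density U /\
         {in `]0, +oo[ &, nondecreasing_fun (fun rho => U rho / rho)}
  | _ => [/\ energy_density U,
             convex_function (`[0, +oo[%classic : set R) U
           & forall (cs : k.-tuple R) (rho : R),
               (forall i, 1 <= tnth cs i) -> 0 <= rho ->
               0 <= iter_Delta cs (pressure U) rho]
  end.

Definition gaussian_domain (R : realType) (s : R) (j : nat) : set (R -> R) :=
  [set V | pressure_class j V /\
           finite_valued (lebesgue_measure2 R) (gaussian2 s) V].

Definition gaussian_codomain (R : realType) (j : nat) : set (R -> R) :=
  [set U | pressure_class j.+1 U /\ continuous_at0 U].

(* Main.v *)
From HB Require Import structures.
Require Import Defs.
From mathcomp Require Import all_boot all_order all_algebra.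
From mathcomp Require Import all_classical all_reals all_analysis measurable_realfun.
From mathcomp Require Import ring lra.

(** The map [y |-> x - |y|^2 / (2 s)] pushes the plane Lebesgue measure forward
    to [a = 2 pi s] times the Lebesgue measure on []-oo, x]], because annuli have
    area [pi] times the difference of their squared radii.  Hence [U = Pi V]
    satisfies [U (e^x) = \int_(z <= x) a V (e^z / a) dz], that is
    [r U'(r) = a V (r / a)].  Thus [U] is convex iff [V r / r] is nondecreasing,
    and the inverse map is [V u = u U'_+ (a u)].  One degree higher,
    [P_U r = a V (r / a) - U r] and [r P_U'(r) = a P_V (r / a)]: an extra dilation
    difference of [P_U] is a weighted integral of [P_V], and conversely [P_V] is a
    limit of rescaled dilation differences of [P_U].  That [V] is convex when
    [P_U] has nonnegative second dilation differences comes from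
    [d U' = P_V (r / a) a / r^2 dr]: [U'] is a convex function of [- 1 / r].
    As [P_U] vanishes at [0+], nonnegative differences of some order force those
    of all lower orders to be nonnegative.  Derivatives of convex functions are
    handled through subgradients, and integrated by cutting intervals into small
    pieces. *)

Set Implicit Arguments.
Unset Strict Implicit.
Unset Printing Implicit Defensive.

Import Order.TTheory GRing.Theory Num.Theory.
Import numFieldNormedType.Exports.

Local Open Scope classical_set_scope.
Local Open Scope ring_scope.

(** * Subgradients of convex functions on the half-line *)

Section subgradients.
Context {R : realType}.
Implicit Types (f g m p q F P Q U V G : R -> R) (cs : seq R).

(* Telescoping over [n] equal pieces of [[a, b]] gives
   [A a - A b <= (M b - M a) * (b - a) / n]. *)
Lemma le_of_small_increments (A M : R -> R) (a b : R) : a <= b ->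
  (forall x y, a <= x -> x <= y -> y <= b ->
    A x - A y <= (M y - M x) * (y - x)) ->
  A a <= A b.
Proof.
move=> ab H.
have key (n : nat) : (A a - A b) * n.+1%:R <= (M b - M a) * (b - a).
  pose t (i : nat) := a + (b - a) * (i%:R / n.+1%:R).
  have n0 : n.+1%:R != 0 :> R by rewrite pnatr_eq0.
  have t0 : t 0%N = a by rewrite /t mul0r mulr0 addr0.
  have tn : t n.+1 = b by rewrite /t divff// mulr1 addrC subrK.
  have tS i : t i.+1 - t i = (b - a) / n.+1%:R by rewrite /t -natr1; field.
  have tD i j : (i <= j)%N -> t i <= t j.
    by move=> ij; rewrite /t lerD2l ler_wpM2l ?subr_ge0// ler_wpM2r ?invr_ge0// ler_nat.
  have SA := telescope_sumr (A \o t) (leq0n n.+1).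
  have SM := telescope_sumr (M \o t) (leq0n n.+1).
  rewrite /= t0 tn in SA SM.
  rewrite -ler_pdivlMr ?ltr0n// -mulrA -SM -opprB -SA mulr_suml -sumrN.
  rewrite !big_nat ler_sum// => i /andP[_ i_n].
  have at_ k : a <= t k by rewrite -[leLHS]t0 tD.
  have tb k : (k <= n.+1)%N -> t k <= b by move=> kn; rewrite -[leRHS]tn tD.
  by rewrite opprB -(tS i); apply: H => //; [exact: tD|exact: tb].
rewrite leNgt; apply/negP => AbAa.
have D0 : 0 < A a - A b by rewrite subr_gt0.
have := key (Num.bound `|(M b - M a) * (b - a) / (A a - A b)|).
apply/negP; rewrite -ltNge -ltr_pdivrMl// mulrC.
apply: (le_lt_trans (ler_norm _)); apply: (lt_trans (archi_boundP _)) => //.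
by rewrite ltr_nat.
Qed.

(** The two increments lie in the same range, of width [(g y - g x) * (y - x)], so
    [le_of_small_increments] applies to both differences. This identifies a convex function with the
    integral of a subgradient without differentiating either. *)
Lemma eq_of_increment_bounds f1 f2 g (a b : R) : a <= b ->
  (forall x y, a <= x -> x <= y -> y <= b ->
    g x * (y - x) <= f1 y - f1 x <= g y * (y - x)) ->
  (forall x y, a <= x -> x <= y -> y <= b ->
    g x * (y - x) <= f2 y - f2 x <= g y * (y - x)) ->
  f1 b - f1 a = f2 b - f2 a.
Proof.
move=> ab H1 H2; apply/eqP; rewrite eq_le.
have h1 : f1 a - f2 a <= f1 b - f2 b.
  apply: (@le_of_small_increments (fun x => f1 x - f2 x) g) => // x y ax xy yb.
  by have /andP[? ?] := H1 _ _ ax xy yb; have /andP[? ?] := H2 _ _ ax xy yb; lra.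
have h2 : f2 a - f1 a <= f2 b - f1 b.
  apply: (@le_of_small_increments (fun x => f2 x - f1 x) g) => // x y ax xy yb.
  by have /andP[? ?] := H1 _ _ ax xy yb; have /andP[? ?] := H2 _ _ ax xy yb; lra.
by apply/andP; split; lra.
Qed.

(** Base points are positive, since a convex function on the half-line may have slope minus infinity
    at [0]; the supporting lines must still lie below [f] at the endpoint [y = 0]. *)
Definition subgradient f g := forall x y, 0 < x -> 0 <= y -> g x * (y - x) <= f y - f x.

Lemma subgradient_nondecreasing f g x y : subgradient f g ->
  0 < x -> x <= y -> g x <= g y.
Proof.
move=> fg x0; rewrite le_eqVlt => /predU1P[->//|xy].
have y0 := lt_trans x0 xy.
have := fg _ _ x0 (ltW y0); have := fg _ _ y0 (ltW x0) => h1 h2.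
have : g x * (y - x) <= g y * (y - x) by lra.
by rewrite ler_pM2r// subr_gt0.
Qed.

Lemma subgradient_bounds f g x y : subgradient f g -> 0 < x -> x <= y ->
  g x * (y - x) <= f y - f x <= g y * (y - x).
Proof.
move=> fg x0 xy; have y0 := lt_le_trans x0 xy.
have := fg _ _ x0 (ltW y0); have := fg _ _ y0 (ltW x0) => h1 h2.
by apply/andP; split; lra.
Qed.

Lemma subgradient_convex f g : subgradient f g ->
  convex_function (`[0, +oo[%classic : set R) f.
Proof.
move=> fg t x y; rewrite !inE/= !in_itv/= !andbT => x0 y0.
pose u : R := t%:num; pose z : R := u * x + (1 - u) * y.
change (f z <= u * f x + (1 - u) * f y).
have u0 : 0 <= u by rewrite /u.
have u1 : 0 <= 1 - u by rewrite subr_ge0 /u.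
have : 0 <= z by rewrite addr_ge0// mulr_ge0.
rewrite le_eqVlt => /predU1P[z0|z0]; last first.
  have h1 := ler_wpM2l u0 (fg _ _ z0 x0); have h2 := ler_wpM2l u1 (fg _ _ z0 y0).
  have : u * (g z * (x - z)) + (1 - u) * (g z * (y - z)) = 0 by rewrite /z; ring.
  lra.
(* No supporting line is available at [z = 0]. There [u * x] and [(1 - u) * y] both vanish, and in
   each case the convexity inequality is an equality. *)
have /eqP := esym z0; rewrite paddr_eq0 ?mulr_ge0// => /andP[].
rewrite !mulf_eq0 => /orP[/eqP u00|/eqP x00].
  rewrite u00 subr0 oner_eq0 => /= /eqP y00.
  by rewrite -z0 y00 mul0r add0r mul1r.
move=> /orP[/eqP u10|/eqP y00]; last by rewrite -z0 x00 y00; lra.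
have -> : u = 1 by lra.
by rewrite -z0 x00 subrr mul0r addr0 mul1r.
Qed.

(** The chord inequality, cross-multiplied: [y] is the combination of [x] and [z] with weight
    [(z - y) / (z - x)] on [x]. *)
Lemma convex_slope f x y z : convex_function (`[0, +oo[%classic : set R) f ->
  0 <= x -> x < y -> y < z -> (f y - f x) * (z - y) <= (f z - f y) * (y - x).
Proof.
move=> cf x0 xy yz; have xz := lt_trans xy yz.
have zx0 : 0 < z - x by rewrite subr_gt0.
pose u := (z - y) / (z - x).
have u0 : 0 <= u by rewrite divr_ge0 ?subr_ge0 ?ltW.
have u1 : u <= 1 by rewrite ler_pdivrMr// mul1r lerD2l lerN2 ltW.
have := cf (Itv01 u0 u1) x z; rewrite !inE/= !in_itv/= !andbT.
move=> /(_ x0 (ltW (le_lt_trans x0 xz))) h.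
have {h} : f (u * x + (1 - u) * z) <= u * f x + (1 - u) * f z by exact: h.
have -> : u * x + (1 - u) * z = y by rewrite /u; field; rewrite gt_eqF.
move=> h; have := ler_wpM2r (ltW zx0) h.
have -> : (u * f x + (1 - u) * f z) * (z - x) = (z - y) * f x + (y - x) * f z.
  by rewrite /u; field; rewrite gt_eqF.
lra.
Qed.

(** The difference quotient is nondecreasing in [h] and bounded below by every chord to the left of
    [x], so its limit exists and is its infimum. *)
Lemma right_derivative_spec f x : convex_function (`[0, +oo[%classic : set R) f ->
  0 < x ->
  [/\ (f (x + h) - f x) / h @[h --> 0^'+] --> right_derivative f x,
      forall h, 0 < h -> right_derivative f x <= (f (x + h) - f x) / h
    & forall y, 0 <= y -> y < x -> (f x - f y) / (x - y) <= right_derivative f x].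
Proof.
move=> cf x0; pose q h := (f (x + h) - f x) / h.
have q_left y h : 0 <= y -> y < x -> 0 < h -> (f x - f y) / (x - y) <= q h.
  move=> y0 yx h0; have xh : x < x + h by rewrite ltrDl.
  have := convex_slope cf y0 yx xh.
  by rewrite addrAC subrr add0r ler_pdivrMr ?subr_gt0// mulrAC ler_pdivlMr.
have qmono : {in `]0, +oo[ &, nondecreasing_fun q}.
  move=> h k; rewrite !in_itv/= !andbT => h0 k0; rewrite le_eqVlt => /predU1P[->//|hk].
  have := @convex_slope f x (x + h) (x + k) cf (ltW x0).
  rewrite ltrDl ltrD2l => /(_ h0 hk) H.
  by rewrite /q ler_pdivrMr// mulrAC ler_pdivlMr//; lra.
have qlb : has_lbound (q @` `]0, +oo[).
  exists ((f x - f 0) / (x - 0)) => _ [h h0 <-]; apply: q_left => //.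
  by move: h0; rewrite /= in_itv/= andbT.
have qcvg : q h @[h --> 0^'+] --> inf (q @` `]0, +oo[) by exact: nondecreasing_at_right_cvgr.
have qn0 : q @` `]0, +oo[ !=set0 by exists (q 1), 1 => //=; rewrite in_itv/= ltr01.
have rE : right_derivative f x = inf (q @` `]0, +oo[) by exact: cvg_lim qcvg.
split; first by rewrite rE.
- move=> h h0; rewrite rE; apply: ge_inf => //; exists h => //=.
  by rewrite in_itv/= h0.
- move=> y y0 yx; rewrite rE; apply: lb_le_inf => // _ [h h0 <-]; apply: q_left => //.
  by move: h0; rewrite /= in_itv/= andbT.
Qed.

Lemma convex_subgradient f : convex_function (`[0, +oo[%classic : set R) f ->
  subgradient f (right_derivative f).
Proof.
move=> cf x y x0 y0; have [_ H1 H2] := right_derivative_spec cf x0.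
have [xy|yx|->] := ltgtP x y; last by rewrite !subrr mulr0.
  have xy0 : 0 < y - x by rewrite subr_gt0.
  by have := H1 _ xy0; rewrite ler_pdivlMr// subrKC.
have := H2 _ y0 yx; rewrite ler_pdivrMr ?subr_gt0//; lra.
Qed.

(** The difference quotient lies between [g x] and [g (x + h)]: among the subgradients, right
    continuity singles out the right derivative. *)
Lemma subgradient_right_derivative f g x : subgradient f g -> 0 < x ->
  g (x + h) @[h --> 0^'+] --> g x -> right_derivative f x = g x.
Proof.
move=> fg x0 gx; apply: cvg_lim => //.
apply: (squeeze_cvgr _ (cvg_cst (g x)) gx).
near=> h; have h0 : 0 < h by near: h; exact: nbhs_right_gt.
have /(subgradient_bounds fg x0) : x <= x + h by rewrite lerDl ltW.
by rewrite addrAC subrr add0r ler_pdivlMr// ler_pdivrMr.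
Unshelve. all: by end_near. Qed.

(** The quantity [x * g x - f x] is minus the height at the origin of the supporting line at [x],
    and this height goes down as the line steepens. *)
Lemma subgradient_pressure_nondecreasing f g x y : subgradient f g ->
  0 < x -> x <= y -> x * g x - f x <= y * g y - f y.
Proof.
move=> fg x0 xy; have y0 := lt_le_trans x0 xy.
have := fg _ _ y0 (ltW x0); have := subgradient_nondecreasing fg x0 xy.
by move=> /(ler_wpM2l (ltW x0)); lra.
Qed.

(** Strict sublevel sets of a convex function are intervals, and the sets to be measured are their
    complements in the half-line. *)
Lemma convex_measurable U : convex_function (`[0, +oo[%classic : set R) U ->
  measurable_fun (`[0, +oo[%classic : set R) U.
Proof.
move=> cU; have mD : measurable (`[0, +oo[%classic : set R) by exact: measurable_itv.
apply: (measurability (@RGenCInfty.G R)) => [|/= _ [_] [r] -> <-].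
  exact: RGenCInfty.measurableE.
rewrite (_ : _ `&` _ = `[0, +oo[%classic `\` [set x | 0 <= x /\ U x < r]).
  apply: measurableD => //; apply: is_interval_measurable.
  move=> x y /= [x0 xr] [y0 yr] z /andP[xz zy].
  have z0 := le_trans x0 xz; split => //.
  move: xz zy; rewrite !le_eqVlt => /predU1P[<-//|xz] /predU1P[->//|zy].
  have := convex_slope cU x0 xz zy.
  have xz' : 0 < z - x by rewrite subr_gt0.
  have zy' : 0 < y - z by rewrite subr_gt0.
  move=> h; rewrite ltNge; apply/negP => rz.
  have : (r - U x) * (y - z) <= (U z - U x) * (y - z) by apply: ler_wpM2r; [exact: ltW|lra].
  have : (U y - U z) * (z - x) <= (U y - r) * (z - x) by apply: ler_wpM2r; [exact: ltW|lra].
  have : 0 < (r - U x) * (y - z) by rewrite mulr_gt0// subr_gt0.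
  have : (U y - r) * (z - x) < 0 by rewrite nmulr_rlt0// subr_lt0.
  lra.
apply/seteqP; split => x /=; rewrite !in_itv/= !andbT.
  by move=> [x0 rx]; split => // -[_]; rewrite ltNge rx.
by move=> [x0 H]; split => //; rewrite leNgt; apply/negP => xr; apply: H.
Qed.

Lemma convex_ratio U x y : convex_function (`[0, +oo[%classic : set R) U -> U 0 = 0 ->
  0 < x -> x <= y -> U x / x <= U y / y.
Proof.
move=> cU U0 x0; rewrite le_eqVlt => /predU1P[->//|xy].
have y0 := lt_trans x0 xy.
have := convex_slope cU (lexx 0) x0 xy; rewrite U0 !subr0 => h.
rewrite ler_pdivrMr// mulrAC ler_pdivlMr//; lra.
Qed.

Lemma subgradient_dilation f m c : 0 < c -> subgradient f m ->
  subgradient (fun x => c * f (x / c)) (fun x => m (x / c)).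
Proof.
move=> c0 fm x y x0 y0.
have := ler_wpM2l (ltW c0) (fm _ _ (divr_gt0 x0 c0) (divr_ge0 y0 (ltW c0))).
rewrite mulrCA (_ : c * (y / c - x / c) = y - x); first lra.
by field; rewrite gt_eqF.
Qed.

(** Later [f x / x] is the slope of a marginalisation; its right continuity makes it the right
    derivative. *)
Lemma subgradient_quotient_cvg f m x : subgradient f m -> 0 < x ->
  {homo (fun x => f x / x) : x y / 0 < x /\ x <= y >-> x <= y} ->
  f (x + h) / (x + h) @[h --> 0^'+] --> f x / x.
Proof.
move=> fm x0 mono.
(* For [h <= 1] one has [f (x + h) <= f x + m (x + 1) * h]; dividing by [x + h >= x] shows that the
   quotient exceeds [f x / x] by at most [C * h]. *)
pose C := `|m (x + 1) - f x / x| / x.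
have cC : f x / x + C * h @[h --> 0^'+] --> f x / x.
  rewrite -[X in _ --> X]addr0 -[X in _ --> _ + X](mulr0 C).
  apply: (@cvgD _ R^o _ _ _ (fun=> f x / x) (fun h => C * h)); first exact: cvg_cst.
  apply: (@cvgM _ _ _ _ (fun=> C) id); first exact: cvg_cst.
  by apply: cvg_at_right_filter; exact: cvg_id.
apply: (squeeze_cvgr _ (cvg_cst (f x / x)) cC).
near=> h; have h0 : 0 < h by near: h; exact: nbhs_right_gt.
have h1 : h <= 1 by near: h; exact: nbhs_right_le.
have xh0 : 0 < x + h by rewrite addr_gt0.
apply/andP; split; first by apply: mono; split => //; rewrite lerDl ltW.
have /andP[_] := subgradient_bounds fm x0 (ltW (ltr_pwDr h0 (lexx x))).
rewrite addrAC subrr add0r => H.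
have mm : m (x + h) <= m (x + 1).
  by apply: (subgradient_nondecreasing fm) => //; rewrite lerD2l.
have H1 : f (x + h) <= f x + m (x + 1) * h.
  by have := ler_wpM2r (ltW h0) mm; lra.
rewrite ler_pdivrMr//; apply: (le_trans H1).
have C0 : 0 <= C by rewrite divr_ge0// ltW.
have CE : C * x = `|m (x + 1) - f x / x| by rewrite divfK// gt_eqF.
have fE : f x = f x / x * x by rewrite divfK// gt_eqF.
move: (f x / x) fE CE => g fE CE.
have : (m (x + 1) - g) * h <= C * x * h by rewrite CE ler_wpM2r ?ler_norm// ltW.
have : 0 <= C * h * h by rewrite mulr_ge0 ?(ltW h0)// mulr_ge0// ltW.
rewrite fE; lra.
Unshelve. all: by end_near. Qed.

End subgradients.

(** * Iterated dilation differences *)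

Section iterated_differences.
Context {R : realType}.
Implicit Types (f g F P Q U V G : R -> R) (cs : seq R).

(** The expansion into signed dilations allows errors to be estimated term by term. The factors are
    at least [1], so positive points stay positive. *)
Lemma iter_DeltaE (cs : seq R) : all (>= 1) cs ->
  exists2 L : seq (R * R),
    {in L, forall p : R * R, `|p.1| = 1 /\ 1 <= p.2} &
    forall (F : R -> R) x, iter_Delta cs F x = \sum_(p <- L) p.1 * F (p.2 * x).
Proof.
elim: cs => [_|c cs IH /= /andP[c1 /IH[L HL LE]]].
  exists [:: (1, 1)]; first by move=> p; rewrite inE => /eqP ->; rewrite normr1.
  by move=> F x; rewrite big_seq1 /= !mul1r.
exists ([seq (p.1, p.2 * c) | p <- L] ++ [seq (- p.1, p.2) | p <- L]).
  move=> p; rewrite mem_cat => /orP[] /mapP[q /HL[q1 q2] ->] /=; split => //.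
    by rewrite -[1]mulr1 ler_pM.
  by rewrite normrN.
move=> F x; rewrite /Delta !LE big_cat/= !big_map/=; congr (_ + _).
  by apply: eq_bigr => p _; rewrite mulrA.
by rewrite -sumrN; apply: eq_bigr => p _; rewrite mulNr.
Qed.

(** Dilation differences commute, because the dilations do. *)
Lemma iter_Delta_Delta (cs : seq R) c (F : R -> R) :
  iter_Delta cs (Delta c F) = iter_Delta (c :: cs) F.
Proof.
elim: cs => [//|d cs IH]; rewrite /= IH; apply/funext => x.
by rewrite /Delta/= /Delta; rewrite (mulrCA c d); ring.
Qed.

Lemma iter_Delta_scale cs F a k x :
  iter_Delta cs (fun x => k * F (a * x)) x = k * iter_Delta cs F (a * x).
Proof.
elim: cs x => [//|c cs IH] x; rewrite /= /Delta !IH.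
by rewrite mulrBr (mulrCA a c).
Qed.

Lemma eq_iter_Delta (F F' : R -> R) cs x : (forall x, 0 < x -> F x = F' x) ->
  all (>= 1) cs -> 0 < x -> iter_Delta cs F x = iter_Delta cs F' x.
Proof.
move=> FF' cs1 x0; have [L HL LE] := iter_DeltaE cs1.
rewrite !LE !big_seq; apply: eq_bigr => p /HL[_ p1].
by rewrite FF'// mulr_gt0// (lt_le_trans ltr01).
Qed.

Lemma iter_Delta_cvg (Fn : nat -> R -> R) F cs : all (>= 1) cs ->
  (forall x, 0 < x -> Fn n x @[n --> \oo] --> F x) ->
  forall x, 0 < x -> iter_Delta cs (Fn n) x @[n --> \oo] --> iter_Delta cs F x.
Proof.
move=> + H; elim: cs => [//|c cs IH /= /andP[c1 /IH {}IH]] x x0.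
apply: (@cvgB _ R^o _ _ _
  (fun n => iter_Delta cs (Fn n) (c * x)) (fun n => iter_Delta cs (Fn n) x)).
  by apply: IH; rewrite mulr_gt0// (lt_le_trans ltr01).
exact: IH.
Qed.

Definition vanishes_at0 F := forall e : R, 0 < e ->
  exists2 d, 0 < d & forall r, 0 < r -> r < d -> `|F r| <= e.

Lemma iter_Delta_vanishes F cs : all (>= 1) cs -> vanishes_at0 F ->
  vanishes_at0 (iter_Delta cs F).
Proof.
move=> + F0; elim: cs => [//|c cs IH /= /andP[c1 /IH H]] e e0.
have [d d0 Hd] := H (e / 2) (divr_gt0 e0 (ltr0Sn _ 1)).
have c0 : 0 < c := lt_le_trans ltr01 c1.
exists (d / c); first by rewrite divr_gt0.
move=> r r0; rewrite ltr_pdivlMr// mulrC => crd; rewrite /Delta.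
have rd : r < d by apply: le_lt_trans crd; rewrite ler_peMl// ltW.
have h1 := Hd _ (mulr_gt0 c0 r0) crd; have h2 := Hd _ r0 rd.
by have := ler_normB (iter_Delta cs F (c * r)) (iter_Delta cs F r); lra.
Qed.

(* If [Delta c F] is nonnegative for all [c >= 1] then [F] is nondecreasing, hence
   at least its limit [0] at the origin. *)
Lemma iter_Delta_descend F n m : vanishes_at0 F -> (m <= n)%N ->
  (forall cs x, size cs = n -> all (>= 1) cs -> 0 < x -> 0 <= iter_Delta cs F x) ->
  (forall cs x, size cs = m -> all (>= 1) cs -> 0 < x -> 0 <= iter_Delta cs F x).
Proof.
move=> F0; elim: n => [|n IH]; first by rewrite leqn0 => /eqP ->.
rewrite leq_eqVlt => /predU1P[->//|mn] H; apply: IH => // cs x scs cs1 x0.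
apply/ler_addgt0Pl => e e0; have [d d0 Hd] := iter_Delta_vanishes cs1 F0 e0.
(* Dilating the small point [r] by [x / r] leads to [x], and the value left over at [r] costs at
   most [e]. *)
pose r := Num.min x (d / 2).
have r0 : 0 < r by rewrite lt_min x0 divr_gt0.
have rd : r < d by rewrite gt_min; apply/orP; right; lra.
have xr1 : 1 <= x / r by rewrite ler_pdivlMr// mul1r ge_min lexx.
have := H (x / r :: cs) r; rewrite /= scs xr1 cs1 => /(_ erefl isT r0).
rewrite /Delta divfK ?gt_eqF//.
have := Hd _ r0 rd; rewrite ler_norml => /andP[]; lra.
Qed.

(* The bounds make [Q] the derivative of [P] with respect to [ln x]; in an
   increment of [iter_Delta cs P] it leaves an error that [le_of_small_increments]
   absorbs. *)
Lemma iter_Delta_log_derivative P Q cs c rho : all (>= 1) cs -> 1 <= c -> 0 < rho ->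
  (forall x y, 0 < x -> x <= y ->
    Q x * (1 - x / y) <= P y - P x <= Q y * (y / x - 1)) ->
  (forall x, 0 < x -> 0 <= iter_Delta cs Q x) ->
  0 <= iter_Delta (c :: cs) P rho.
Proof.
move=> cs1 c1 rho0 HPQ HQ; rewrite /= /Delta subr_ge0.
have [L HL LE] := iter_DeltaE cs1.
(* The error of the term with factor [d] is at most [(y * Q (d * y) - x * Q (d * x)) * (y - x) / (x
   * y)], and [rho ^- 2] bounds [1 / (x * y)] to the right of [rho]. *)
pose M t := rho ^- 2 * \sum_(p <- L) t * Q (p.2 * t).
apply: (@le_of_small_increments _ _ M); first by rewrite ler_peMl// ltW.
move=> x y rx; rewrite le_eqVlt => /predU1P[->|xy] yc; first by rewrite !subrr mulr0.
have x0 := lt_le_trans rho0 rx; have y0 := lt_trans x0 xy.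
have yx0 : 0 < y - x by rewrite subr_gt0.
pose e (d : R) := P (d * y) - P (d * x) - Q (d * x) * (1 - x / y).
have HAE : iter_Delta cs P y - iter_Delta cs P x =
    (1 - x / y) * iter_Delta cs Q x + \sum_(p <- L) p.1 * e p.2.
  rewrite !LE mulr_sumr -sumrB -big_split/=; apply: eq_bigr => p _; rewrite /e; ring.
have He (p : R * R) : p \in L -> `|p.1 * e p.2| <=
    (rho ^- 2 * (y * Q (p.2 * y)) - rho ^- 2 * (x * Q (p.2 * x))) * (y - x).
  move=> /HL[p1 p2]; have d0 : 0 < p.2 by exact: lt_le_trans p2.
  rewrite normrM p1 mul1r; set d := p.2 in d0 *.
  have dx0 : 0 < d * x by rewrite mulr_gt0.
  have dxy : d * x <= d * y by rewrite ler_pM2l// ltW.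
  have /andP[h1 h2] := HPQ _ _ dx0 dxy.
  have E1 : d * x / (d * y) = x / y by field; rewrite !gt_eqF.
  have E2 : d * y / (d * x) = y / x by field; rewrite !gt_eqF.
  rewrite E1 in h1; rewrite E2 in h2.
  have e0 : 0 <= e d by rewrite /e subr_ge0.
  rewrite ger0_norm//.
  have h3 : e d <= (y * Q (d * y) - x * Q (d * x)) * (y - x) / (x * y).
    rewrite /e lerBlDr; apply: (le_trans h2); rewrite le_eqVlt; apply/orP; left; apply/eqP.
    by field; rewrite !gt_eqF.
  have h4 : 0 <= (y * Q (d * y) - x * Q (d * x)) * (y - x).
    by have := le_trans e0 h3; rewrite pmulr_lge0// invr_gt0 mulr_gt0.
  apply: (le_trans h3); rewrite -mulrBr -[leRHS]mulrA [leRHS]mulrC; apply: ler_wpM2l => //.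
  rewrite lef_pV2 ?posrE ?mulr_gt0 ?exprn_gt0// expr2 ler_pM// ?ltW//.
  exact: le_lt_trans xy.
rewrite -opprB HAE opprD.
have h5 : 0 <= (1 - x / y) * iter_Delta cs Q x.
  by rewrite mulr_ge0 ?HQ// subr_ge0 ler_pdivrMr// mul1r ltW.
apply: (@le_trans _ _ (- \sum_(p <- L) p.1 * e p.2)); first by lra.
apply: (le_trans (ler_norm _)); rewrite normrN; apply: (le_trans (ler_norm_sum _ _ _)).
rewrite /M !mulr_sumr -sumrB mulr_suml big_seq [leRHS]big_seq.
by apply: ler_sum => p; exact: He.
Qed.

End iterated_differences.

(** * Convexity from second differences *)

Section second_differences.
Context {R : realType}.
Implicit Types (f g m p q F P Q U V G : R -> R) (cs : seq R).

Lemma ler_addinvn (x y z : R) : (forall n : nat, x <= y + z / n.+1%:R) -> x <= y.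
Proof.
move=> H; rewrite leNgt; apply/negP => yx.
have d0 : 0 < x - y by rewrite subr_gt0.
have := H (Num.bound `|z / (x - y)|); apply/negP; rewrite -ltNge -ltrBrDl.
rewrite ltr_pdivrMr// -ltr_pdivrMl// mulrC.
apply: (le_lt_trans (ler_norm _)); apply: (lt_trans (archi_boundP _)) => //.
by rewrite ltr_nat.
Qed.

(* A monotone function with nonnegative second differences is convex: the floor
   of the ratio of the two increments reduces their comparison to a common step. *)
Lemma second_difference_slopes p x h k : {homo p : x y / x <= y} ->
  (forall x h k, 0 <= h -> 0 <= k -> p (x + h) - p x <= p (x + k + h) - p (x + k)) ->
  0 < h -> 0 < k -> (p x - p (x - k)) / k <= (p (x + h) - p x) / h.
Proof.
move=> pmono p2 h0 k0; set D := p x - p (x - k).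
have D0 : 0 <= D by rewrite subr_ge0 pmono// gerBl ltW.
rewrite ler_pdivlMr// mulrAC.
apply: (@ler_addinvn _ _ D) => n.
pose dl := k / n.+1%:R; have dl0 : 0 < dl by rewrite divr_gt0// ltr0n.
have n0 : n.+1%:R != 0 :> R by rewrite pnatr_eq0.
pose d0 := p x - p (x - dl).
have up (m : nat) : m%:R * d0 <= p (x + m%:R * dl) - p x.
  elim: m => [|m IH]; first by rewrite !mul0r addr0 subrr.
  have := p2 (x - dl) dl (m.+1%:R * dl) (ltW dl0) (mulr_ge0 (ler0n _ _) (ltW dl0)).
  rewrite subrK -/d0 (_ : x - dl + _ + _ = x + m.+1%:R * dl); last by rewrite -natr1; ring.
  rewrite (_ : x - dl + _ = x + m%:R * dl); last by rewrite -natr1; ring.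
  rewrite -natr1; lra.
have dn (m : nat) : p x - p (x - m%:R * dl) <= m%:R * d0.
  elim: m => [|m IH]; first by rewrite !mul0r subr0 subrr.
  have := p2 (x - m.+1%:R * dl) dl (m%:R * dl) (ltW dl0) (mulr_ge0 (ler0n _ _) (ltW dl0)).
  rewrite (_ : x - m.+1%:R * dl + m%:R * dl + dl = x); last by rewrite -natr1; ring.
  rewrite (_ : x - m.+1%:R * dl + m%:R * dl = x - dl); last by rewrite -natr1; ring.
  rewrite (_ : x - m.+1%:R * dl + dl = x - m%:R * dl); last by rewrite -natr1; ring.
  rewrite -/d0 -natr1; lra.
have DE : D <= n.+1%:R * d0.
  by have := dn n.+1; rewrite (_ : n.+1%:R * dl = k)//; rewrite /dl; field.
have hd0 : 0 <= h / dl by rewrite divr_ge0 ?ltW.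
have /andP[m1 m2] := truncn_itv hd0; set m := Num.truncn (h / dl) in m1 m2.
have d0D : D / n.+1%:R <= d0 by rewrite ler_pdivrMr ?ltr0n// mulrC.
have h1 : m%:R * d0 <= p (x + h) - p x.
  apply: (le_trans (up m)); rewrite lerD2r pmono// lerD2l.
  by rewrite -ler_pdivlMr.
have h2 : (h / dl - 1) * (D / n.+1%:R) <= m%:R * d0.
  apply: (@le_trans _ _ (m%:R * (D / n.+1%:R))); last by rewrite ler_wpM2l.
  rewrite ler_wpM2r ?divr_ge0// lerBlDr; move: m2; rewrite -natr1; lra.
rewrite -lerBlDr; apply: le_trans (le_trans h2 h1).
rewrite le_eqVlt; apply/orP; left; apply/eqP; rewrite /dl; field.
by rewrite nat1r n0 gt_eqF.
Qed.

(** The supremum of the left slopes at a point dominates each of them and is dominated by every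
    right slope there, hence is a subgradient. *)
Lemma second_difference_subgradient p : {homo p : x y / x <= y} ->
  (forall x h k, 0 <= h -> 0 <= k -> p (x + h) - p x <= p (x + k + h) - p (x + k)) ->
  exists q, forall x y, q x * (y - x) <= p y - p x.
Proof.
move=> pmono p2; pose S x := [set (p x - p (x - k)) / k | k in `]0, +oo[].
have Sub x h : 0 < h -> ubound (S x) ((p (x + h) - p x) / h).
  move=> h0 _ [k + <-]; rewrite /= in_itv/= andbT => k0.
  exact: second_difference_slopes.
have S0 x : S x !=set0 by exists ((p x - p (x - 1)) / 1), 1 => //=; rewrite in_itv/= ltr01.
have Ssup x : has_sup (S x) by split=> //; exists ((p (x + 1) - p x) / 1); exact: Sub.
exists (fun x => sup (S x)) => x y; have [xy|yx|->] := ltgtP x y; last by rewrite !subrr mulr0.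
  have yx0 : 0 < y - x by rewrite subr_gt0.
  rewrite -ler_pdivlMr//; apply: ge_sup => //.
  by have := Sub x _ yx0; rewrite subrKC.
have xy0 : 0 < x - y by rewrite subr_gt0.
have : (p x - p y) / (x - y) <= sup (S x).
  apply: ub_le_sup; first by case: (Ssup x).
  by exists (x - y); rewrite /= ?in_itv/= ?xy0// subKr.
rewrite ler_pdivrMr//; lra.
Qed.

(* [Q] is the slope of [P x = x * G x - U x] in the variable [ln x]; as
   [dP = x dG], it is also the slope of [G] in the variable [- x^-1]. *)
Lemma reciprocal_subgradient U G : subgradient U G ->
  (forall c d x, 1 <= c -> 1 <= d -> 0 < x ->
     0 <= iter_Delta [:: c; d] (fun x => x * G x - U x) x) ->
  exists Q, (forall x, 0 < x -> 0 <= Q x) /\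
    forall x y, 0 < x -> 0 < y -> Q x * (x^-1 - y^-1) <= G y - G x.
Proof.
move=> UG H; pose P x := x * G x - U x.
have Pmono x y : 0 < x -> x <= y -> P x <= P y by exact: subgradient_pressure_nondecreasing.
(* In the variable [ln x], dilation differences become ordinary differences. *)
pose p x := P (expR x).
have pmono : {homo p : x y / x <= y}.
  by move=> x y xy; apply: Pmono; rewrite ?expR_gt0// ler_expR.
have p2 x h k : 0 <= h -> 0 <= k -> p (x + h) - p x <= p (x + k + h) - p (x + k).
  move=> h0 k0; have := H (expR h) (expR k) (expR x).
  rewrite -!expR0 !ler_expR => /(_ h0 k0 (expR_gt0 _)).
  rewrite /= /Delta -/(P _) -/(P _) -/(P _) -/(P _) -!expRD -!/(p _).
  rewrite (_ : k + (h + x) = x + k + h); last by ring.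
  by rewrite (addrC h x) (addrC k x); lra.
have [q Hq] := second_difference_subgradient pmono p2.
have q0 x : 0 <= q x.
  have := Hq x (x - 1); have : p (x - 1) <= p x by apply: pmono; rewrite gerBl.
  lra.
have qmono x y : x <= y -> q x <= q y.
  rewrite le_eqVlt => /predU1P[->//|xy].
  have h1 := Hq x y; have h2 := Hq y x.
  have : q x * (y - x) <= q y * (y - x) by lra.
  by rewrite ler_pM2r// subr_gt0.
pose Q x := q (ln x).
have PQ x y : 0 < x -> 0 < y -> Q x * (ln y - ln x) <= P y - P x.
  by move=> x0 y0; have := Hq (ln x) (ln y); rewrite /p !lnK.
have lnB (x y : R) : 0 < x -> 0 < y -> ln y - ln x <= (y - x) / x.
  move=> x0 y0; rewrite -ln_div ?posrE//.
  have yx0 : 0 < y / x by rewrite divr_gt0.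
  have := expR_ge1Dx (ln (y / x)); rewrite lnK//.
  by rewrite mulrBl divff ?gt_eqF//; lra.
have PG x y : 0 < x -> x <= y -> x * (G y - G x) <= P y - P x <= y * (G y - G x).
  move=> x0 xy; have := subgradient_bounds UG x0 xy; rewrite /P => /andP[h1 h2].
  by apply/andP; split; lra.
have Gmono := subgradient_nondecreasing UG.
(* The weights [(y - x) / y ^+ 2] here and [(y - x) / x ^+ 2] in [hi] agree with [x^-1 - y^-1] up to
   second order in [y - x], an error that [le_of_small_increments] absorbs. *)
have lo x y : 0 < x -> x <= y -> Q x * (y - x) / y ^+ 2 <= G y - G x.
  move=> x0 xy; have y0 := lt_le_trans x0 xy.
  have /andP[_ h1] := PG _ _ x0 xy.
  have h2 := PQ _ _ x0 y0; have h3 := lnB _ _ y0 x0.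
  rewrite ler_pdivrMr ?exprn_gt0//.
  have h4 : (y - x) / y <= ln y - ln x by rewrite -opprB mulNr; lra.
  have h5 := ler_wpM2l (q0 (ln x)) h4.
  have h6 : Q x * ((y - x) / y) <= y * (G y - G x) by rewrite /Q in h2 *; lra.
  have := ler_wpM2r (ltW y0) h6.
  rewrite -!mulrA mulVf ?gt_eqF// mulr1; lra.
have hi x y : 0 < x -> x <= y -> G y - G x <= Q y * (y - x) / x ^+ 2.
  move=> x0 xy; have y0 := lt_le_trans x0 xy.
  have /andP[h1 _] := PG _ _ x0 xy.
  have h2 := PQ _ _ y0 x0; have h3 := lnB _ _ x0 y0.
  rewrite ler_pdivlMr ?exprn_gt0//.
  have h5 := ler_wpM2l (q0 (ln y)) h3.
  have h6 : x * (G y - G x) <= Q y * ((y - x) / x) by rewrite /Q in h2 *; lra.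
  have := ler_wpM2r (ltW x0) h6.
  rewrite -[in leRHS]mulrA divfK ?gt_eqF// expr2; lra.
exists Q; split; first by move=> x _; exact: q0.
move=> x y x0 y0; have [xy|yx] := leP x y.
  suff : G x + Q x / x <= G y + Q x / y by lra.
  (* The constant comes from [u * v ^+ 2 >= x ^+ 3] for [x <= u <= v]; the case [y < x] below uses
     [y ^+ 3] likewise. *)
  apply: (@le_of_small_increments _
    (fun t => G t + Q x / t) (fun t => Q x / x ^+ 3 * t)) => //.
  move=> u v xu uv vy; have u0 := lt_le_trans x0 xu; have v0 := lt_le_trans u0 uv.
  have h1 := lo _ _ u0 uv.
  have QQ : Q x <= Q u by apply: qmono; rewrite ler_ln.
  have h2 : Q x * (v - u) / v ^+ 2 <= Q u * (v - u) / v ^+ 2.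
    by apply: ler_wpM2r; [rewrite invr_ge0 exprn_ge0// ltW|rewrite ler_wpM2r// subr_ge0].
  have E : Q x / u - Q x / v - Q x * (v - u) / v ^+ 2 = Q x * (v - u) ^+ 2 / (u * v ^+ 2).
    by field; rewrite !gt_eqF.
  have h3 : Q x * (v - u) ^+ 2 / (u * v ^+ 2) <= Q x * (v - u) ^+ 2 / x ^+ 3.
    apply: ler_wpM2l; first exact: mulr_ge0 (q0 _) (sqr_ge0 _).
    have xv := le_trans xu uv.
    rewrite lef_pV2 ?posrE ?mulr_gt0 ?exprn_gt0// exprS.
    apply: ler_pM; rewrite ?exprn_ge0 ?(ltW x0)//.
    by rewrite ler_pXn2r// ?nnegrE ltW.
  rewrite -mulrBr (_ : Q x / x ^+ 3 * (v - u) * (v - u) =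
    Q x * (v - u) ^+ 2 / x ^+ 3); last by ring.
  lra.
suff : - Q x / y - G y <= - Q x / x - G x by lra.
apply: (@le_of_small_increments _
  (fun t => - Q x / t - G t) (fun t => Q x / y ^+ 3 * t)); first exact: ltW.
move=> u v yu uv vx; have u0 := lt_le_trans y0 yu; have v0 := lt_le_trans u0 uv.
have h1 := hi _ _ u0 uv.
have QQ : Q v <= Q x by apply: qmono; rewrite ler_ln.
have h2 : Q v * (v - u) / u ^+ 2 <= Q x * (v - u) / u ^+ 2.
  by apply: ler_wpM2r; [rewrite invr_ge0 exprn_ge0// ltW|rewrite ler_wpM2r// subr_ge0].
have E : Q x * (v - u) / u ^+ 2 - (Q x / u - Q x / v) = Q x * (v - u) ^+ 2 / (u ^+ 2 * v).
  by field; rewrite !gt_eqF.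
have h3 : Q x * (v - u) ^+ 2 / (u ^+ 2 * v) <= Q x * (v - u) ^+ 2 / y ^+ 3.
  apply: ler_wpM2l; first exact: mulr_ge0 (q0 _) (sqr_ge0 _).
  have yv := le_trans yu uv.
  rewrite lef_pV2 ?posrE ?mulr_gt0 ?exprn_gt0// exprSr.
  apply: ler_pM; rewrite ?exprn_ge0 ?(ltW y0)//.
  by rewrite ler_pXn2r// ?nnegrE ltW.
rewrite -mulrBr (_ : Q x / y ^+ 3 * (v - u) * (v - u) =
  Q x * (v - u) ^+ 2 / y ^+ 3); last by ring.
lra.
Qed.

(** As [G] is a convex function of [- x^-1], [V] is a perspective of that function. With
    [Q r / r ^+ 2] in the role of the derivative of [G] at [r = c * u], the slope of [V] at [u] is
    [G r + Q r / r]. At the endpoint [0] the supporting inequality is the nonnegativity of [Q]. *)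
Lemma convex_of_reciprocal_subgradient V G Q (c : R) : 0 < c ->
  V 0 = 0 -> (forall u, 0 < u -> V u = u * G (c * u)) ->
  (forall x, 0 < x -> 0 <= Q x) ->
  (forall x y, 0 < x -> 0 < y -> Q x * (x^-1 - y^-1) <= G y - G x) ->
  convex_function (`[0, +oo[%classic : set R) V.
Proof.
move=> c0 V0 VE Q0 HQ.
apply: (@subgradient_convex _ _ (fun u => G (c * u) + Q (c * u) / (c * u))) => x y x0.
have cx0 : 0 < c * x by rewrite mulr_gt0.
have E : Q (c * x) / (c * x) * x = Q (c * x) / c by field; rewrite !gt_eqF.
rewrite le_eqVlt => /predU1P[<-|y0].
  rewrite V0 VE// sub0r mulrN mulrDl E.
  have : 0 <= Q (c * x) / c by rewrite divr_ge0 ?Q0// ltW.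
  lra.
have cy0 : 0 < c * y by rewrite mulr_gt0.
rewrite !VE//; have := ler_wpM2l (ltW y0) (HQ _ _ cx0 cy0).
have -> : y * (Q (c * x) * ((c * x)^-1 - (c * y)^-1)) = Q (c * x) / (c * x) * (y - x).
  by field; rewrite !gt_eqF.
lra.
Qed.

End second_differences.

(** * Pressure *)

Section pressures.
Context {R : realType}.
Implicit Types (f g m p q F P Q U V G : R -> R) (cs : seq R).

(** The point [rho = 0] drops out: dilations fix it and the pressure vanishes there. *)
Lemma pressure_classSP k (U : R -> R) : pressure_class k.+1 U <->
  [/\ energy_density U, convex_function (`[0, +oo[%classic : set R) U
    & forall cs rho, size cs = k.+1 -> all (>= 1) cs -> 0 < rho ->
        0 <= iter_Delta cs (pressure U) rho].
Proof.
split=> [[? ? H]|[? ? H]]; split => //.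
  move=> cs rho /eqP scs cs1 rho0; apply: (H (Tuple scs)); last exact: ltW.
  by move=> i; move/allP : cs1; apply; rewrite mem_tnth.
move=> cs rho cs1; rewrite le_eqVlt => /predU1P[<-|rho0].
  have /iter_DeltaE[L _ ->] : all (>= 1) cs by apply/all_tnthP.
  by rewrite big1// => p _; rewrite mulr0 /pressure eqxx mulr0.
by apply: H; rewrite ?size_tuple//; apply/all_tnthP.
Qed.

Lemma continuous_at0P (U : R -> R) : U 0 = 0 -> continuous_at0 U <->
  forall e : R, 0 < e -> exists2 d, 0 < d & forall r, 0 <= r -> r < d -> `|U r| <= e.
Proof.
move=> U0; rewrite /continuous_at0 U0; split.
  move=> /cvgrPdist_le H e e0; have := H e e0.
  rewrite near_withinE => /nbhs_ballP[d /= d0 Hd]; exists d => // r r0 rd.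
  have := Hd r; rewrite /ball/= sub0r normrN ger0_norm// => /(_ rd).
  by rewrite in_itv/= r0 => /(_ isT); rewrite sub0r normrN.
move=> H; apply/cvgrPdist_le => e e0; have [d d0 Hd] := H e e0.
rewrite near_withinE; apply/nbhs_ballP; exists d => //= r.
rewrite /ball/= sub0r normrN in_itv/= andbT => rd r0.
by rewrite sub0r normrN; apply: Hd => //; rewrite ger0_norm in rd.
Qed.

Lemma convex_pressure_Delta U c x : convex_function (`[0, +oo[%classic : set R) U ->
  1 <= c -> 0 < x -> 0 <= Delta c (pressure U) x.
Proof.
move=> cU c1 x0; rewrite /Delta subr_ge0.
have cx0 : 0 < c * x by rewrite mulr_gt0// (lt_le_trans ltr01).
rewrite /pressure !gt_eqF//; apply: subgradient_pressure_nondecreasing => //.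
  exact: convex_subgradient.
by rewrite ler_peMl// ltW.
Qed.

(** Testing the subgradient at [r] against [0] and [2 * r] gives
    [U r <= r * G r <= U (2 * r) - U r]. *)
Lemma subgradient_weight_vanishes U G : U 0 = 0 -> continuous_at0 U -> subgradient U G ->
  vanishes_at0 (fun r => r * G r).
Proof.
move=> U0 cU UG e e0.
have [d d0 Hd] := (continuous_at0P U0).1 cU (e / 2) (divr_gt0 e0 (ltr0Sn _ 1)).
exists (d / 2); first by rewrite divr_gt0.
move=> r r0 rd; have r20 : 0 < 2 * r by rewrite mulr_gt0.
have h1 : `|U r| <= e / 2 by apply: Hd; [exact: ltW|lra].
have h2 : `|U (2 * r)| <= e / 2 by apply: Hd; [exact: ltW|lra].
have h3 := UG _ _ r0 (lexx 0); have h4 := UG _ _ r0 (ltW r20).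
move: h1 h2; rewrite !ler_norml => /andP[? ?] /andP[? ?].
by apply/andP; split; lra.
Qed.

Lemma pressure_vanishes U : convex_function (`[0, +oo[%classic : set R) U ->
  U 0 = 0 -> continuous_at0 U -> vanishes_at0 (pressure U).
Proof.
move=> convU U0 cU e e0; have e20 : 0 < e / 2 by rewrite divr_gt0.
have [d d0 Hd] := subgradient_weight_vanishes U0 cU (convex_subgradient convU) e20.
have [d' d'0 Hd'] := (continuous_at0P U0).1 cU _ e20.
exists (Num.min d d'); first by rewrite lt_min d0.
move=> r r0; rewrite lt_min => /andP[rd rd'].
rewrite /pressure gt_eqF//.
have := ler_normB (r * right_derivative U r) (U r).
by have := Hd _ r0 rd; have := Hd' _ (ltW r0) rd'; lra.
Qed.

(** Since [g] has slope [f x / x], the derivative of [f - g] with respect to [ln x] is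
    [x * m x - f x]. The bounds have the form that [iter_Delta_log_derivative] takes. *)
Lemma log_derivative_bounds f g m x y : subgradient f m ->
  subgradient g (fun x => f x / x) -> 0 < x -> x <= y ->
  (x * m x - f x) * (1 - x / y) <= (f y - g y) - (f x - g x)
    <= (y * m y - f y) * (y / x - 1).
Proof.
move=> fm gf x0 xy; have y0 := lt_le_trans x0 xy.
have /andP[h1 h2] := subgradient_bounds gf x0 xy.
have /andP[h3 h4] := subgradient_bounds fm x0 xy.
have xy0 : 0 <= x / y by rewrite divr_ge0 ?ltW.
have yx0 : 0 <= y / x by rewrite divr_ge0 ?ltW.
have E1 : f y / y * (y - x) = f y - f y * (x / y) by field; rewrite gt_eqF.
have E2 : f x / x * (y - x) = f x * (y / x) - f x by field; rewrite gt_eqF.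
have E3 : (x * m x - f x) * (1 - x / y) = (f x + m x * (y - x)) * (x / y) - f x.
  by field; rewrite gt_eqF.
have E4 : (y * m y - f y) * (y / x - 1) = f y - (f y - m y * (y - x)) * (y / x).
  by field; rewrite gt_eqF.
rewrite E1 in h2; rewrite E2 in h1; rewrite E3 E4; apply/andP; split.
  have : (f x + m x * (y - x)) * (x / y) <= f y * (x / y) by apply: ler_wpM2r => //; lra.
  lra.
have : (f y - m y * (y - x)) * (y / x) <= f x * (y / x) by apply: ler_wpM2r => //; lra.
lra.
Qed.

Lemma pressure_class_ratio j V : pressure_class j V ->
  energy_density V /\ forall x y, 0 < x -> x <= y -> V x / x <= V y / y.
Proof.
case: j => [[eV mono]|j /pressure_classSP[eV cV _]]; split => // x y x0 xy.
  by apply: mono; rewrite // in_itv/= andbT// (lt_le_trans x0).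
by apply: convex_ratio => //; case: eV.
Qed.

(** The relation [pressure U (a * x) = a * V x - U (a * x)] turns the rescaled difference into
    difference quotients of [V] and [U] with positive steps. Their limits combine to
    [u * right_derivative V u - V u]. *)
Lemma pressure_dilation_cvg U V a u : 0 < a -> 0 < u ->
  convex_function (`[0, +oo[%classic : set R) U ->
  convex_function (`[0, +oo[%classic : set R) V ->
  (forall x, 0 < x -> V x = x * right_derivative U (a * x)) ->
  n.+1%:R / a * Delta (1 + n.+1%:R^-1) (pressure U) (a * u) @[n --> \oo] --> pressure V u.
Proof.
move=> a0 u0 cU cV VE; have au0 : 0 < a * u by rewrite mulr_gt0.
have [dU _ _] := right_derivative_spec cU au0.
have [dV _ _] := right_derivative_spec cV u0.
have seq0 (c : R) : 0 < c -> (forall n : nat, 0 < c * n.+1%:R^-1) /\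
    c * n.+1%:R^-1 @[n --> \oo] --> (0 : R).
  move=> c0; split; first by move=> n; rewrite mulr_gt0 ?invr_gt0 ?ltr0n.
  rewrite -[X in _ --> X](mulr0 c).
  by apply: (@cvgM _ _ _ _ (fun=> c)); [exact: cvg_cst|exact: cvg_harmonic].
have sU := (cvg_at_rightP _ _ _).1 dU _ (seq0 _ au0).
have sV := (cvg_at_rightP _ _ _).1 dV _ (seq0 _ u0).
have -> : pressure V u = u * right_derivative V u - u * right_derivative U (a * u).
  by rewrite /pressure gt_eqF// -VE.
have -> : (fun n : nat => n.+1%:R / a * Delta (1 + n.+1%:R^-1) (pressure U) (a * u)) =
  (fun n : nat => u * ((V (u + u * n.+1%:R^-1) - V u) / (u * n.+1%:R^-1)) -
    u * ((U (a * u + a * u * n.+1%:R^-1) - U (a * u)) / (a * u * n.+1%:R^-1))).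
  apply/funext => n; have n0 : n.+1%:R != 0 :> R by rewrite pnatr_eq0.
  have t0 : 0 < n.+1%:R^-1 :> R by rewrite invr_gt0 ltr0n.
  set t : R := n.+1%:R^-1 in t0 *.
  have tE : n.+1%:R = t^-1 by rewrite invrK.
  have x0 : 0 < u + u * t by rewrite addr_gt0// mulr_gt0.
  have PE x : 0 < x -> pressure U (a * x) = a * V x - U (a * x).
    by move=> ?; rewrite /pressure gt_eqF ?mulr_gt0// VE// mulrA.
  rewrite /Delta (_ : (1 + t) * (a * u) = a * (u + u * t)); last by ring.
  rewrite !PE// tE (_ : a * u + a * u * t = a * (u + u * t)); last by ring.
  by field; rewrite !gt_eqF.
apply: (@cvgB _ R^o _ _ _
  (fun n => u * ((V (u + u * n.+1%:R^-1) - V u) / (u * n.+1%:R^-1)))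
  (fun n => u * ((U (a * u + a * u * n.+1%:R^-1) - U (a * u)) / (a * u * n.+1%:R^-1)))).
  by apply: (@cvgM _ _ _ _ (fun=> u)); [exact: cvg_cst|exact: sV].
by apply: (@cvgM _ _ _ _ (fun=> u)); [exact: cvg_cst|exact: sU].
Qed.

Lemma iter_Delta_pressure_dilation U V a cs x : 0 < a -> 0 < x ->
  convex_function (`[0, +oo[%classic : set R) U ->
  convex_function (`[0, +oo[%classic : set R) V ->
  (forall x, 0 < x -> V x = x * right_derivative U (a * x)) ->
  all (>= 1) cs ->
  (forall c x, 1 <= c -> 0 < x -> 0 <= iter_Delta (c :: cs) (pressure U) x) ->
  0 <= iter_Delta cs (pressure V) x.
Proof.
move=> a0 x0 cU cV VE cs1 H.
have := iter_Delta_cvg cs1 (fun u u0 => pressure_dilation_cvg a0 u0 cU cV VE) x0.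
move=> /cvgr_to_ge; apply; apply: nearW => n.
rewrite (iter_Delta_scale cs (Delta (1 + n.+1%:R^-1) (pressure U))) iter_Delta_Delta.
apply: mulr_ge0; first by rewrite divr_ge0// ltW.
by apply: H; rewrite ?mulr_gt0// lerDl invr_ge0.
Qed.

End pressures.

(** * Integrals over half-lines *)

Section halfline.
Context {R : realType}.
Local Notation leb := (@lebesgue_measure R).

Lemma expR_subn_cvg (y : R) : expR (y - n%:R) @[n --> \oo] --> (0 : R).
Proof.
apply/cvgrPdist_le => e e0; near=> n.
rewrite sub0r normrN ger0_norm ?expR_ge0//.
rewrite -[leRHS]lnK ?posrE// ler_expR lerBlDl -lerBlDr.
near: n; exact: nbhs_infty_ger.
Unshelve. all: by end_near. Qed.

Lemma integral_expR (x y : R) : x <= y ->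
  \int[leb]_(z in `[x, y]) expR z = expR y - expR x.
Proof.
rewrite le_eqVlt => /predU1P[->|xy].
  by rewrite set_itv1 Rintegral_set1 subrr.
rewrite /Rintegral (@continuous_FTC2 _ _ expR)//.
- by apply: continuous_subspaceT; exact: continuous_expR.
- split => [z _||]; first exact: derivable_expR.
  + by apply: cvg_at_right_filter; exact: continuous_expR.
  + by apply: cvg_at_left_filter; exact: continuous_expR.
- by move=> z _; rewrite derive1E derive_val.
Qed.

Lemma integrable_expR_itv (x y : R) : leb.-integrable `[x, y] (EFin \o expR).
Proof.
apply: continuous_compact_integrable; first exact: segment_compact.
by apply: continuous_subspaceT; exact: continuous_expR.
Qed.

Lemma ge0_cvg_integral_itvNy (f : R -> R) (y : R) :
  measurable_fun `]-oo, y] f -> (forall z, z <= y -> 0 <= f z) ->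
  (\int[leb]_(z in `[(y - n%:R)%R, y]) (f z)%:E @[n --> \oo] -->
   \int[leb]_(z in `]-oo, y]) (f z)%:E)%E.
Proof.
move=> mf f0; rewrite itvNy_bnd_bigcup_BLeft.
apply: (@ge0_nondecreasing_set_cvg_integral _ (measurableTypeR R) R
  (fun n => `[y - n%:R, y]%classic) (EFin \o f) leb).
- move=> m n mn; apply/subsetPset => z /=; rewrite !in_itv/= => /andP[+ ->].
  by rewrite andbT; apply: le_trans; rewrite lerB// ler_nat.
- by move=> n; exact: measurable_itv.
- move=> n; apply/measurable_EFinP; apply: measurable_funS mf => // z /=.
  by rewrite !in_itv/= => /andP[_ ->].
- by move=> n z /=; rewrite in_itv/= => /andP[_ zy]; rewrite lee_fin f0.
Qed.

Lemma ge0_integral_itvNy (f Phi : R -> R) (L y : R) :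
  measurable_fun `]-oo, y] f -> (forall z, z <= y -> 0 <= f z) ->
  (forall x, x <= y -> (\int[leb]_(z in `[x, y]) (f z)%:E = (L - Phi x)%:E)%E) ->
  Phi (y - n%:R) @[n --> \oo] --> (0 : R) ->
  (\int[leb]_(z in `]-oo, y]) (f z)%:E = L%:E)%E.
Proof.
move=> mf f0 fPhi Phi0.
have := ge0_cvg_integral_itvNy mf f0.
have -> : (fun n => \int[leb]_(z in `[(y - n%:R)%R, y]) (f z)%:E)%E =
    EFin \o (fun n => L - Phi (y - n%:R)).
  by apply/funext => n; rewrite fPhi// gerBl.
move=> h; have : EFin \o (fun n => L - Phi (y - n%:R)) @ \oo --> L%:E.
  apply: cvg_EFin; first exact: nearW.
  rewrite -[X in _ --> X]subr0.
  by apply: (@cvgB _ R^o _ _ _ (fun=> L)); [exact: cvg_cst|exact: Phi0].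
by move: h => /cvg_unique h /h; apply.
Qed.

(** The tails are dominated by those of the absolute value, which shrink with the endpoint and are
    the remainders of a monotone convergence. *)
Lemma integral_itvNy_cvg0 (f : R -> R) (y : R) :
  leb.-integrable `]-oo, y] (EFin \o f) ->
  forall e : R, 0 < e -> exists2 x0, x0 <= y & forall x, x <= x0 ->
    `|\int[leb]_(z in `]-oo, x]) f z| <= e.
Proof.
move=> intf e e0.
have subI (x x' : R) : x <= x' -> `]-oo, x]%classic `<=` `]-oo, x']%classic.
  by move=> xx' z /=; rewrite !in_itv/= => /le_trans; apply.
have intx x : x <= y -> leb.-integrable `]-oo, x] (EFin \o f).
  by move=> xy; apply: integrableS intf => //; exact: subI.
pose g z := `|f z|.
have intg : leb.-integrable `]-oo, y] (EFin \o g) by exact: integrable_norm.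
have mg : measurable_fun `]-oo, y] g.
  by move/integrableP : intg => [/measurable_EFinP].
have g0 z : 0 <= g z by rewrite /g.
have intgx x : x <= y -> leb.-integrable `]-oo, x] (EFin \o g).
  by move=> xy; apply: integrableS intg => //; exact: subI.
pose I x := \int[leb]_(z in `]-oo, x]) g z.
have mono x x' : x <= x' -> x' <= y -> I x <= I x'.
  move=> xx' x'y; rewrite -subr_ge0 /I (@Rintegral_itvB _ _ -oo%O (BRight x'))//.
  - by apply: Rintegral_ge0.
  - exact: intgx.
have cvgI : I (y - n%:R) @[n --> \oo] --> (0 : R).
  have h := @ge0_cvg_integral_itvNy g y mg (fun z _ => g0 z).
  have E : (\int[leb]_(z in `]-oo, y]) (g z)%:E = (I y)%:E)%E.
    by rewrite /I /Rintegral fineK//; exact: integrable_fin_num.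
  rewrite E in h; move/fine_cvg : h => h.
  have -> : (fun n => I (y - n%:R)) =
      (fun n => I y - (fine \o (fun n => \int[leb]_(z in `[(y - n%:R)%R, y]) (g z)%:E)%E) n).
    apply/funext => n /=; have yn : y - n%:R <= y by rewrite gerBl.
    rewrite -[fine _]/(\int[leb]_(z in `[(y - n%:R), y]) g z).
    rewrite -Rintegral_itv_obnd_cbnd.
      by rewrite -(@Rintegral_itvB _ _ -oo%O (BRight y))// -/(I y) -/(I (y - n%:R)) subKr.
    apply: integrableS intg => // z /=; first by rewrite !in_itv/= => /andP[_ ->].
  rewrite -[X in _ --> X](subrr (I y)).
  by apply: (@cvgB _ R^o _ _ _ (fun=> I y)); [exact: cvg_cst|exact: h].
move/cvgrPdist_le : cvgI => /(_ _ e0)[N _ /(_ N (leqnn N))] /=.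
rewrite sub0r normrN => IN.
exists (y - N%:R); first by rewrite gerBl.
move=> x xN; have xy : x <= y by rewrite (le_trans xN)// gerBl.
apply: le_trans IN; apply: le_trans (ler_norm _).
apply: (@le_trans _ _ (I x)); last by apply: mono => //; rewrite gerBl.
by apply: le_normr_Rintegral => //; exact: intx.
Qed.

(** The integral is the difference of those of the positive and negative parts, and such a
    difference is a finite number only if both are. This turns [finite_valued] into
    integrability. *)
Lemma integrable_of_fin_num (D : set R) (f : R -> R) : measurable D -> measurable_fun D f ->
  (\int[leb]_(z in D) (f z)%:E)%E \is a fin_num -> leb.-integrable D (EFin \o f).
Proof.
move=> mD mf; have mEf : measurable_fun D (EFin \o f) by exact/measurable_EFinP.
rewrite integralE fin_numB => /andP[fp fn]; apply/integrableP; split => //.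
have -> : (\int[leb]_(z in D) `|(EFin \o f) z| =
    \int[leb]_(z in D) ((EFin \o f)^\+ \+ (EFin \o f)^\-) z)%E.
  by rewrite -fune_abse.
rewrite ge0_integralD//; last 2 first.
- exact: measurable_funepos.
- exact: measurable_funeneg.
by rewrite lte_add_pinfty// ltey_eq ?fp ?fn.
Qed.

(** * Primitives of monotone slopes in logarithmic coordinates *)

Section primitive_of_subgradient.
Variable G : R -> R.
Hypothesis Gmono : forall x y, 0 < x -> x <= y -> G x <= G y.
(** This is [G r dr] under [r = expR z]; the half-line up to [y] becomes the interval from the
    origin to [expR y]. *)
Local Notation F := (fun z => G (expR z) * expR z).

Lemma measurable_mul_expR (D : set R) : measurable D -> measurable_fun D F.
Proof.
move=> mD; apply: measurable_funM; last first.
  by apply: measurable_funTS; exact: measurable_expR.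
apply: nondecreasing_measurable => // x y xy.
by apply: Gmono; rewrite ?expR_gt0// ler_expR.
Qed.

Lemma integrable_mul_expR (x y : R) : leb.-integrable `[x, y] (EFin \o F).
Proof.
have [xy|yx] := leP x y; last first.
  by rewrite set_itv_ge ?bnd_simp -?ltNge//; exact: integrable_set0.
apply: measurable_bounded_integrable => //.
- by rewrite /= lebesgue_measure_itv/= lte_fin; case: ifP => // _; rewrite -EFinB ltry.
- exact: measurable_mul_expR.
exists ((`|G (expR x)| + `|G (expR y)|) * expR y); split; first exact: num_real.
move=> M HM z; rewrite /= in_itv/= => /andP[xz zy]; apply: le_trans (ltW HM).
rewrite normrM [X in _ * X]ger0_norm ?expR_ge0// ler_pM ?expR_ge0// ?ler_expR//.
have := Gmono (expR_gt0 x); rewrite -ler_expR in xz => /(_ _ xz) h1.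
have := Gmono (expR_gt0 z); rewrite -ler_expR in zy => /(_ _ zy) h2.
rewrite ler_norml; apply/andP; split.
  have := ler_norm (- G (expR x)); rewrite normrN; have := normr_ge0 (G (expR y)); lra.
have := ler_norm (G (expR y)); have := normr_ge0 (G (expR x)); lra.
Qed.

Lemma integral_mul_expR_bounds (x y : R) : x <= y ->
  G (expR x) * (expR y - expR x) <= \int[leb]_(z in `[x, y]) F z
    <= G (expR y) * (expR y - expR x).
Proof.
move=> xy; have iF := integrable_mul_expR x y.
have ie c : leb.-integrable `[x, y] (EFin \o (fun z => c * expR z)).
  rewrite (_ : _ \o _ = fun z => c%:E * (EFin \o expR) z)%E//.
  by apply: integrableZl => //; exact: integrable_expR_itv.
have E c : \int[leb]_(z in `[x, y]) (c * expR z) = c * (expR y - expR x).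
  rewrite RintegralZl//; last exact: integrable_expR_itv.
  by rewrite integral_expR.
rewrite -!E; apply/andP; split; apply: le_Rintegral => // z;
  rewrite /= in_itv/= => /andP[xz zy];
  by rewrite ler_wpM2r ?expR_ge0// Gmono// ?expR_gt0// ler_expR.
Qed.

(** Increments of [U] are integrals of the monotone [G], which gives the supporting inequality
    between positive points. Vanishing tails give continuity at [0], through which the inequality
    extends to that endpoint. *)
Lemma subgradient_of_integral (U : R -> R) : U 0 = 0 ->
  (forall x, leb.-integrable `]-oo, x] (EFin \o F)) ->
  (forall x, U (expR x) = \int[leb]_(z in `]-oo, x]) F z) ->
  continuous_at0 U /\ subgradient U G.
Proof.
move=> U0 iF UE.
have cU : continuous_at0 U.
  apply/(continuous_at0P U0) => e e0.
  have [x0 _ Hx] := integral_itvNy_cvg0 (iF 0) e0.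
  exists (expR x0); first exact: expR_gt0.
  move=> r; rewrite le_eqVlt => /predU1P[<-|r0] rx; first by rewrite U0 normr0 ltW.
  by rewrite -(lnK r0) UE; apply: Hx; rewrite -ler_expR lnK// ltW.
split => //.
have UB x y : x <= y -> U (expR y) - U (expR x) = \int[leb]_(z in `[x, y]) F z.
  move=> xy; rewrite !UE (@Rintegral_itvB _ _ -oo%O (BRight y))//.
  rewrite Rintegral_itv_obnd_cbnd//; apply: integrableS (integrable_mul_expR x y) => //.
  by move=> z /=; rewrite !in_itv/= => /andP[/ltW -> ->].
have pos x y : 0 < x -> 0 < y -> G x * (y - x) <= U y - U x.
  move=> x0 y0; have [xy|yx] := leP x y.
    have lxy : ln x <= ln y by rewrite ler_ln.
    by have := integral_mul_expR_bounds lxy; rewrite -UB// !lnK// => /andP[].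
  have lyx : ln y <= ln x by rewrite ler_ln// ltW.
  have := integral_mul_expR_bounds lyx; rewrite -UB// !lnK// => /andP[]; lra.
move=> x y x0; rewrite le_eqVlt => /predU1P[<-|y0]; last exact: pos.
rewrite U0 !sub0r mulrN lerN2; apply/ler_addgt0Pr => e e0.
have [d d0 Hd] := (continuous_at0P U0).1 cU (e / 2) (divr_gt0 e0 (ltr0Sn _ 1)).
have G1 : 0 < `|G x| + 1 by rewrite ltr_wpDl.
(* Small enough that [U t] and [G x * t], the two costs of replacing the endpoint [0] by [t], are at
   most [e / 2] each in absolute value. *)
pose t := Num.min (d / 2) (e / 2 / (`|G x| + 1)).
have t0 : 0 < t by rewrite lt_min !divr_gt0.
have td : t < d by rewrite gt_min; apply/orP; left; lra.
have te : t * (`|G x| + 1) <= e / 2 by rewrite -ler_pdivlMr// ge_min lexx orbT.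
have := pos _ _ x0 t0; have := Hd t (ltW t0) td.
rewrite ler_norml => /andP[_ h1] h2.
have : - (G x * t) <= t * (`|G x| + 1).
  have := ler_wpM2r (ltW t0) (ler_norm (- G x)); rewrite normrN; nra.
lra.
Qed.

(* Subtracting the integrand from [G (expR y) * expR z] makes it nonnegative on
   []-oo, y]], so that monotone convergence applies. *)
Lemma integral_of_subgradient (U : R -> R) (y : R) : U 0 = 0 -> continuous_at0 U ->
  subgradient U G ->
  (\int[leb]_(z in `]-oo, y]) (F z)%:E = (U (expR y))%:E)%E.
Proof.
move=> U0 cU UG.
have UB x : x <= y -> \int[leb]_(z in `[x, y]) F z = U (expR y) - U (expR x).
  move=> xy; pose f r := \int[leb]_(z in `[x, ln r]) F z.
  have fB r t : expR x <= r -> r <= t -> f t - f r = \int[leb]_(z in `[ln r, ln t]) F z.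
    move=> xr rt; have r0 : 0 < r := lt_le_trans (expR_gt0 x) xr.
    have t0 := lt_le_trans r0 rt.
    rewrite /f (@Rintegral_itvB _ _ (BLeft x) (BRight (ln t)))//.
    - rewrite Rintegral_itv_obnd_cbnd//.
      apply: integrableS (integrable_mul_expR (ln r) (ln t)) => //.
      by move=> z /=; rewrite !in_itv/= => /andP[/ltW -> ->].
    - exact: integrable_mul_expR.
    - by rewrite bnd_simp -(expRK x) ler_ln// posrE expR_gt0.
    - by rewrite bnd_simp ler_ln.
  have := @eq_of_increment_bounds R f U G (expR x) (expR y).
  rewrite ler_expR => /(_ xy) <-.
  - by rewrite fB// ?ler_expR// !expRK.
  - move=> r t xr rt ty; have r0 : 0 < r := lt_le_trans (expR_gt0 x) xr.
    have t0 := lt_le_trans r0 rt; have lrt : ln r <= ln t by rewrite ler_ln.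
    by have := integral_mul_expR_bounds lrt; rewrite !lnK// fB.
  - move=> r t xr rt _; have r0 : 0 < r := lt_le_trans (expR_gt0 x) xr.
    exact: subgradient_bounds.
have cvgU : U (expR (y - n%:R)) @[n --> \oo] --> (0 : R).
  apply/cvgrPdist_le => e e0.
  have [d d0 Hd] := (continuous_at0P U0).1 cU e e0.
  have /cvgrPdist_lt/(_ _ d0)[N _ HN] := expR_subn_cvg y.
  exists N => // n /HN; rewrite !sub0r !normrN ger0_norm ?expR_ge0// => h.
  by apply: Hd; rewrite ?expR_ge0.
pose m := G (expR y); pose H z := m * expR z - F z.
have ie x : leb.-integrable `[x, y] (EFin \o (fun z => m * expR z)).
  rewrite (_ : _ \o _ = fun z => m%:E * (EFin \o expR) z)%E//.
  by apply: integrableZl => //; exact: integrable_expR_itv.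
have mexp (D : set R) : measurable D -> measurable_fun D expR.
  by move=> _; apply: measurable_funTS; exact: measurable_expR.
have mH : measurable_fun `]-oo, y] H.
  apply: measurable_funB; last exact: measurable_mul_expR.
  by apply: measurable_funM => //; exact: mexp.
have EFR (f : R -> R) x : leb.-integrable `[x, y] (EFin \o f) ->
    (\int[leb]_(z in `[x, y]) (f z)%:E = (\int[leb]_(z in `[x, y]) f z)%R%:E)%E.
  by move=> h; rewrite /Rintegral fineK//; exact: integrable_fin_num.
have He : (\int[leb]_(z in `]-oo, y]) (expR z)%:E = (expR y)%:E)%E.
  apply: (ge0_integral_itvNy (Phi := expR)); first exact: mexp.
  - by move=> z _; exact: expR_ge0.
  - by move=> x xy; rewrite EFR ?integral_expR//; exact: integrable_expR_itv.
  - exact: expR_subn_cvg.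
have HH : (\int[leb]_(z in `]-oo, y]) (H z)%:E = (m * expR y - U (expR y))%:E)%E.
  apply: (ge0_integral_itvNy (Phi := fun x => m * expR x - U (expR x))) => //.
  - move=> z zy; rewrite /H -mulrBl mulr_ge0 ?expR_ge0// subr_ge0 Gmono ?expR_gt0//.
    by rewrite ler_expR.
  - move=> x xy; rewrite EFR.
      rewrite RintegralB//; last exact: integrable_mul_expR.
      rewrite RintegralZl//; last exact: integrable_expR_itv.
      by rewrite integral_expR// UB//; congr EFin; ring.
    rewrite (_ : _ \o _ = ((EFin \o (fun z => m * expR z)%R) \- (EFin \o F%R))%E)//.
   
    by apply: integrableB => //; exact: integrable_mul_expR.
  - rewrite -[X in _ --> X]subr0 -[X in _ --> X - _](mulr0 m).
    apply: (@cvgB _ R^o _ _ _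
      (fun n => m * expR (y - n%:R)) (fun n => U (expR (y - n%:R)))) => //.
    by apply: (@cvgM _ _ _ _ (fun=> m)); [exact: cvg_cst|exact: expR_subn_cvg].
have iH : leb.-integrable `]-oo, y] (EFin \o H).
  by apply: integrable_of_fin_num => //; rewrite HH.
have iexp : leb.-integrable `]-oo, y] (EFin \o expR).
  by apply: integrable_of_fin_num; rewrite ?He//; exact: mexp.
transitivity (\int[leb]_(z in `]-oo, y]) (m%:E * (expR z)%:E - (H z)%:E))%E.
  by apply: eq_integral => z _; rewrite -EFinM -EFinB /H; congr EFin; ring.
have ime : leb.-integrable `]-oo, y] (fun z => m%:E * (expR z)%:E)%E.
  by apply: (integrableZl _ _ iexp).
transitivity (\int[leb]_(z in `]-oo, y]) (m%:E * (expR z)%:E) -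
    \int[leb]_(z in `]-oo, y]) (H z)%:E)%E; first exact: (integralB _ ime iH).
rewrite HH (_ : (\int[leb]_(z in `]-oo, y]) (m%:E * (expR z)%:E) = m%:E * (expR y)%:E)%E).
  by rewrite -EFinM -EFinB; congr EFin; ring.
by rewrite -He; exact: (integralZl _ iexp).
Qed.

End primitive_of_subgradient.

End halfline.

(** * The Gaussian marginalisation *)

Section gaussian.
Context {R : realType}.
Implicit Types (U V G : R -> R) (cs : seq R).
Local Notation leb := (@lebesgue_measure R).

(** Substituting [x = r * sin t] gives the integrand [2 * r ^+ 2 * cos t ^+ 2], with primitive
    [r ^+ 2 * (t + sin t * cos t)]. *)
Lemma integral_half_circle (r : R) : 0 < r ->
  (\int[leb]_(x in `[(- r)%R, r]) (2 * Num.sqrt (r ^+ 2 - x ^+ 2))%R%:E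
   = (pi * r ^+ 2)%R%:E)%E.
Proof.
move=> r0.
pose F (t : R) := r * sin t.
have dF (t : R) : is_derive t 1 F (r * cos t).
  by rewrite /F; apply: is_derive_eq; rewrite /GRing.scale/= ?mul0r ?addr0 ?mulr1.
have F'E : (derive1 F) = fun t => r * cos t.
  by apply/funext => t; rewrite derive1E; apply: derive_val.
have cF' : continuous (derive1 F).
  rewrite F'E => t; apply: continuousM; first exact: cst_continuous.
  exact: continuous_cos.
have cF : continuous F.
  by move=> t; apply/differentiable_continuous/derivable1_diffP; apply: ex_derive.
have Fb : F (pi / 2) = r by rewrite /F sin_pihalf mulr1.
have Fa : F (- (pi / 2)) = - r by rewrite /F sinN sin_pihalf mulrN1.
have pi2 : - (pi / 2) < pi / 2 :> R by have := pi_gt0 R; lra.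
have -> : `[(- r), r]%classic = `[F (- (pi / 2)), F (pi / 2)]%classic by rewrite Fa Fb.
have c0 : continuous (fun x : R => r ^+ 2 - x ^+ 2).
  move=> x; apply: (@continuousB R R^o R (fun=> r ^+ 2) (fun x => x ^+ 2));
    [exact: cst_continuous|exact: exprn_continuous].
have c1 : continuous (fun x : R => Num.sqrt (r ^+ 2 - x ^+ 2)).
  by move=> x; apply: continuous_comp; [exact: c0|exact: sqrt_continuous].
have c2 : continuous (fun x : R => 2 * Num.sqrt (r ^+ 2 - x ^+ 2)).
  move=> x; apply: (@continuousM R R (fun=> 2) (fun x => Num.sqrt (r ^+ 2 - x ^+ 2)));
    [exact: cst_continuous|exact: c1].
have c3 : continuous (fun t : R => 2 * r ^+ 2 * cos t ^+ 2).
  move=> t; apply: (@continuousM R R (fun=> 2 * r ^+ 2) (fun t => cos t ^+ 2));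
    first exact: cst_continuous.
  apply: (@continuous_comp _ _ _ cos (fun x => x ^+ 2)); first exact: continuous_cos.
  exact: exprn_continuous.
rewrite (integration_by_substitution_increasing
  (G := fun x => 2 * Num.sqrt (r ^+ 2 - x ^+ 2)))//; first last.
- exact: continuous_subspaceT.
- split => [t _||]; first exact: ex_derive.
  + by apply: cvg_at_right_filter; exact: cF.
  + by apply: cvg_at_left_filter; exact: cF.
- by apply/cvg_ex; eexists; apply: cvg_at_left_filter; exact: cF'.
- by apply/cvg_ex; eexists; apply: cvg_at_right_filter; exact: cF'.
- by move=> t u tI uI tu; rewrite /F ltr_pM2l// ltr_sin.
- exact: ltW.
pose H (t : R) := r ^+ 2 * (t + sin t * cos t).
have dH (t : R) : is_derive t 1 H (2 * r ^+ 2 * cos t ^+ 2).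
  rewrite /H; apply: is_derive_eq; rewrite /GRing.scale/= ?mul0r ?addr0 ?mulr1.
  by rewrite mulrN -expr2 sin2cos2; ring.
have key (t : R) : t \in `[(- (pi / 2)), pi / 2] ->
    2 * Num.sqrt (r ^+ 2 - (r * sin t) ^+ 2) * (r * cos t) = 2 * r ^+ 2 * cos t ^+ 2.
  move=> tI; have ct : 0 <= cos t by apply: cos_ge0_pihalf; rewrite in_itv/= in tI.
  have -> : r ^+ 2 - (r * sin t) ^+ 2 = (r * cos t) ^+ 2.
    by rewrite !exprMn sin2cos2; ring.
  by rewrite sqrtr_sqr ger0_norm; [ring|rewrite mulr_ge0// ltW].
transitivity (\int[leb]_(t in `[(- (pi / 2))%R, (pi / 2)%R]) (2 * r ^+ 2 * cos t ^+ 2)%R%:E)%E.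
  by apply: eq_integral => t /[!inE]/= tI; congr EFin; rewrite [LHS]/= F'E; exact: key.
have cH : continuous H.
  by move=> t; apply/differentiable_continuous/derivable1_diffP; apply: ex_derive.
rewrite (@continuous_FTC2 _ _ H)//.
- rewrite /H cosN sinN cos_pihalf -EFinB; congr EFin; field.
- by [].
- exact: continuous_subspaceT.
- split => [t _||]; first exact: ex_derive.
  + by apply: cvg_at_right_filter; exact: cH.
  + by apply: cvg_at_left_filter; exact: cH.
- by move=> t _; rewrite derive1E; apply: derive_val.
Qed.

Lemma lebesgue_measure2_disk (T : R) :
  (lebesgue_measure2 R [set y | (y.1 ^+ 2 + y.2 ^+ 2 < T)%R] =
   (pi * Num.max 0 T)%:E)%E.
Proof.
have [T0|T0] := leP T 0.
  rewrite mulr0 (_ : mkset _ = set0) ?measure0//.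
  rewrite -subset0 => -[x y] /= xyT.
  have := lt_le_trans xyT T0; rewrite ltNge => /negP; apply.
  by rewrite addr_ge0 ?sqr_ge0.
pose r := Num.sqrt T.
have r0 : 0 < r by rewrite sqrtr_gt0.
have rT : r ^+ 2 = T by rewrite sqr_sqrtr// ltW.
rewrite -rT -(integral_half_circle r0).
rewrite /lebesgue_measure2/= /product_measure1 [RHS]integral_mkcond/=.
apply: eq_integral => x _ /=; rewrite patchE.
(* When [r ^+ 2 < x ^+ 2] the square root takes its default value [0], and the interval is empty
   like the section. *)
have -> : xsection [set y | y.1 ^+ 2 + y.2 ^+ 2 < r ^+ 2] x =
    `](- Num.sqrt (r ^+ 2 - x ^+ 2)), (Num.sqrt (r ^+ 2 - x ^+ 2))[%classic.
  apply/seteqP; split => y; rewrite /xsection/= in_itv/= inE/= -ltr_norml.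
    move=> h; rewrite -sqrtr_sqr ltr_sqrt; first by rewrite ltrBrDl.
    by rewrite subr_gt0 (le_lt_trans _ h)// lerDl sqr_ge0.
  move=> h; have [rx|rx] := leP (r ^+ 2 - x ^+ 2) 0.
    by move: h; rewrite ler0_sqrtr// normr_lt0.
  by move: h; rewrite -sqrtr_sqr ltr_sqrt// ltrBrDl.
rewrite lebesgue_measure_itv/= lte_fin.
case: ifPn => h.
  rewrite ifT.
    by rewrite -EFinB; congr EFin; ring.
  rewrite inE/= in_itv/= -ler_norml.
  have : 0 < Num.sqrt (r ^+ 2 - x ^+ 2) by lra.
  rewrite sqrtr_gt0 subr_gt0 -real_normK ?num_real// ltr_sqr ?nnegrE//; last exact: ltW.
  exact: ltW.
have s0 : Num.sqrt (r ^+ 2 - x ^+ 2) = 0.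
  by have := sqrtr_ge0 (r ^+ 2 - x ^+ 2); move: h; rewrite -leNgt; lra.
by rewrite s0 mulr0; case: ifP.
Qed.

(** * The radial push-forward of the plane Lebesgue measure *)

Variable s : R.
Hypothesis s0 : 0 < s.
Local Notation a := (2 * pi * s).
(** Chosen so that [expR (psi x y) / a = expR x * gaussian2 s y]. *)
Local Notation psi x := (fun y : measurableTypeR R * measurableTypeR R =>
  (x - (y.1 ^+ 2 + y.2 ^+ 2) / (2 * s)) : measurableTypeR R).
Local Notation Pi := (marginalisation (lebesgue_measure2 R) (gaussian2 s)).
Local Notation PiE := (marginalisation_ereal (lebesgue_measure2 R) (gaussian2 s)).

Let a0 : 0 < a. Proof. by rewrite !mulr_gt0// pi_gt0. Qed.

Lemma measurable_radial (x : R) : measurable_fun setT (psi x).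
Proof.
apply: measurable_funB => //; apply: measurable_funM => //.
by apply: measurable_funD; apply: measurable_funX.
Qed.

(** The preimage is the annulus where the squared radius is at least [2 * s * (x - be)] and less
    than [2 * s * (x - al)]. The maxima account for bounds beyond [x], where the disks are empty. *)
Lemma pushforward_radial_itv (x al be : R) : al <= be ->
  (pushforward (lebesgue_measure2 R) (psi x) `]al, be] =
   (a * (Num.max 0 (x - al) - Num.max 0 (x - be)))%:E)%E.
Proof.
move=> ab; rewrite /pushforward.
pose D T := [set y : measurableTypeR R * measurableTypeR R | y.1 ^+ 2 + y.2 ^+ 2 < T].
have mD T : measurable (D T).
  rewrite /D.
  have : measurable_fun setT (fun y : measurableTypeR R * measurableTypeR R =>
      y.1 ^+ 2 + y.2 ^+ 2 : measurableTypeR R).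
    by apply: measurable_funD; apply: measurable_funX.
  move=> /(_ measurableT `]-oo, T[%classic) /(_ (measurable_itv _)).
  by rewrite setTI; congr measurable; apply/seteqP; split => y; rewrite /= in_itv.
have -> : psi x @^-1` `]al, be]%classic = D (2 * s * (x - al)) `\` D (2 * s * (x - be)).
  apply/seteqP; split => y; rewrite /D/= in_itv/= .
    move=> /andP[h1 h2]; split.
      by move: h1; rewrite ltrBrDl -ltrBrDr ltr_pdivrMr ?mulr_gt0// mulrC.
    apply/negP; rewrite -leNgt.
    by move: h2; rewrite lerBlDl -lerBlDr ler_pdivlMr ?mulr_gt0// mulrC.
  move=> [h1 /negP]; rewrite -leNgt => h2; apply/andP; split.
    by rewrite ltrBrDl -ltrBrDr ltr_pdivrMr ?mulr_gt0// mulrC.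
  by rewrite lerBlDl -lerBlDr ler_pdivlMr ?mulr_gt0// mulrC.
have ED T : lebesgue_measure2 R (D T) = (pi * Num.max 0 T)%:E := lebesgue_measure2_disk T.
have Doo : (lebesgue_measure2 R (D (2 * s * (x - al))%R) < +oo)%E by rewrite ED ltry.
rewrite (measureD (mD _) (mD _) Doo) setIidr; last first.
  move=> y; rewrite /D/= => /lt_le_trans; apply.
  by rewrite ler_pM2l ?mulr_gt0// lerD2l lerN2.
transitivity ((pi * Num.max 0 (2 * s * (x - al)))%R%:E -
    (pi * Num.max 0 (2 * s * (x - be)))%R%:E)%E.
  by congr (_ - _)%E; exact: ED.
rewrite -EFinB; congr EFin.
have E t : Num.max 0 (2 * s * t) = 2 * s * Num.max 0 t.
  by rewrite maxr_pMr ?mulr0// ltW// mulr_gt0.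
by rewrite !E; ring.
Qed.

(** Uniqueness of Lebesgue measure concerns the whole line, so the rescaled push-forward is
    completed by Lebesgue measure beyond [x]; the sum is then compared with it on half-open
    intervals. *)
Lemma lebesgue_measure_radial (x : R) (A : set (measurableTypeR R)) :
  measurable A -> A `<=` `]-oo, x]%classic ->
  (lebesgue_measure A = (a^-1)%:E * pushforward (lebesgue_measure2 R) (psi x) A)%E.
Proof.
move=> mA Ax.
have ia0 : 0 <= a^-1 by rewrite invr_ge0 ltW.
have mI : measurable (`]x, +oo[%classic : set (measurableTypeR R)) by exact: measurable_itv.
have [nu nuE] : exists nu : {measure set (measurableTypeR R) -> \bar R},
    forall B, nu B = pushforward (lebesgue_measure2 R) (psi x) B.
  by unshelve eexists (pushforward (lebesgue_measure2 R) (psi x));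
    first exact: measurable_radial.
have [m mE] : exists m : {measure set (measurableTypeR R) -> \bar R},
    forall B, m B = ((a^-1)%:E * pushforward (lebesgue_measure2 R) (psi x) B +
      lebesgue_measure (B `&` `]x, +oo[))%E.
  exists (measure_add (mscale (NngNum ia0) nu) (mrestr lebesgue_measure mI)) => B.
  by rewrite -nuE; exact: measure_addE.
rewrite (lebesgue_measure_unique (mu := m))//.
  rewrite mE.
  rewrite (_ : A `&` _ = set0) ?measure0 ?adde0//.
  rewrite -subset0 => y [/Ax] /=; rewrite !in_itv/= andbT => yx xy.
  by have := le_lt_trans yx xy; rewrite ltxx.
move=> _ [[al be] _ <-]/=.
have [ab|ba] := leP al be; last by rewrite set_itv_ge ?measure0// -leNgt bnd_simp ltW.
rewrite mE (pushforward_radial_itv x ab) -EFinM mulKf ?gt_eqF//.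
rewrite (_ : _ `&` _ = `](Num.max al x), be]%classic); last first.
  apply/seteqP; split => y /=; rewrite !in_itv/= andbT gt_max.
    by move=> [/andP[-> ->] ->].
  by move=> /andP[/andP[-> ->] ->].
have L (t u : R) : ((if (t < u)%R then u%:E - t%:E else 0) = (Num.max 0 (u - t)%R)%:E)%E.
  by rewrite -subr_gt0; case: ltP => _; rewrite ?EFinB.
rewrite !lebesgue_measure_itv/= !lte_fin !L -EFinD; congr EFin.
rewrite /Num.max; do !case: ifPn; rewrite -?leNgt => *; lra.
Qed.

Lemma ge0_integral_radial (x : R) (h : R -> \bar R) :
  measurable_fun setT h -> (forall z, 0 <= h z)%E ->
  (\int[lebesgue_measure]_(z in `]-oo, x]) h z =
   \int[lebesgue_measure2 R]_y ((a^-1)%:E * h (psi x y)))%E.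
Proof.
move=> mh h0.
have ia0 : 0 <= a^-1 by rewrite invr_ge0 ltW.
have mpsi := measurable_radial x.
have mD : measurable (`]-oo, x]%classic : set (measurableTypeR R)) by exact: measurable_itv.
have [nu nuE] : exists nu : {measure set (measurableTypeR R) -> \bar R},
    (nu : set (measurableTypeR R) -> \bar R) = pushforward (lebesgue_measure2 R) (psi x).
  by unshelve eexists (pushforward (lebesgue_measure2 R) (psi x)).
rewrite (@eq_measure_integral _ (measurableTypeR R) R _ (mscale (NngNum ia0) nu)); last first.
  move=> A mA AD; change (lebesgue_measure A = ((a^-1)%:E * nu A)%E).
  by rewrite nuE; exact: lebesgue_measure_radial.
rewrite ge0_integral_mscale//; last exact: measurable_funTS.
rewrite nuE ge0_integral_pushforward//; last exact: measurable_funTS.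
rewrite (_ : psi x @^-1` _ = setT); last first.
  apply/seteqP; split => // y _; rewrite /= in_itv/= gerBl divr_ge0 ?addr_ge0 ?sqr_ge0//.
  by rewrite mulr_ge0// ltW.
rewrite ge0_integralZl//; exact: measurableT_comp.
Qed.

(** The variables are changed in the positive and negative parts separately, so the identity also
    covers infinite values. *)
Lemma marginalisation_gaussian2 (V : R -> R) (x : R) :
  measurable_fun (`[0, +oo[%classic : set R) V ->
  (marginalisation_ereal (lebesgue_measure2 R) (gaussian2 s) V (expR x) =
   \int[lebesgue_measure]_(z in `]-oo, x]) (a * V (expR z / a))%:E)%E.
Proof.
move=> mV; pose f z := a * V (expR z / a).
have mf : measurable_fun setT f.
  apply: measurable_funM => //.
  have mg : measurable_fun setT (fun z : R => expR z / a).
    by apply: measurable_funM => //; exact: continuous_measurable_fun continuous_expR.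
  apply: (measurable_comp _ _ mV mg) => //.
    by move=> _ [z _ <-]; rewrite /= in_itv/= andbT divr_ge0 ?expR_ge0// ltW.
have E y : V (expR x * gaussian2 s y) = a^-1 * f (psi x y).
  by rewrite /f mulKf ?gt_eqF// /gaussian2 expRD -mulNr; congr V; ring.
rewrite /marginalisation_ereal integralE [RHS]integralE; congr (_ - _)%E.
  rewrite [RHS]ge0_integral_radial//; last by apply: measurable_funepos; exact/measurable_EFinP.
  apply: eq_integral => y _; rewrite !funeposE E /=.
  by rewrite -!EFin_max -EFinM maxr_pMr ?mulr0// invr_ge0 ltW.
rewrite [RHS]ge0_integral_radial//; last by apply: measurable_funeneg; exact/measurable_EFinP.
apply: eq_integral => y _; rewrite !funenegE E /=.
by rewrite -!EFin_max -EFinM maxr_pMr ?mulr0 ?mulrN// invr_ge0 ltW.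
Qed.

(** * The marginalisation, its inverse, and the pressure classes *)

Lemma marginalisation_ereal_at0 V : V 0 = 0 -> PiE V 0 = 0%E.
Proof.
by move=> V0; rewrite /marginalisation_ereal integral0_eq// => y _; rewrite mul0r V0.
Qed.

(** [G r] is the ratio [V u / u] at [u = r / a], hence nondecreasing, and the integrand
    [a * V (expR z / a)] is [G (expR z) * expR z]: the marginalisation is a primitive of [G]. *)
Lemma marginalisation_subgradient V (G := fun r => a * V (r / a) / r) :
  energy_density V -> (forall x y, 0 < x -> x <= y -> V x / x <= V y / y) ->
  finite_valued (lebesgue_measure2 R) (gaussian2 s) V ->
  [/\ Pi V 0 = 0, continuous_at0 (Pi V) & subgradient (Pi V) G].
Proof.
move=> [mV V0] Vratio finV.
have Pi0 : Pi V 0 = 0 by rewrite /marginalisation marginalisation_ereal_at0.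
have GE r : G r = V (r / a) / (r / a).
  by rewrite /G invf_div; ring.
have Gmono x y : 0 < x -> x <= y -> G x <= G y.
  move=> x0 xy; rewrite !GE; apply: Vratio; first by rewrite divr_gt0.
  by rewrite ler_pM2r// invr_gt0.
have FE z : a * V (expR z / a) = G (expR z) * expR z.
  by rewrite /G divfK// gt_eqF// expR_gt0.
have finF x : (\int[leb]_(z in `]-oo, x]) (G (expR z) * expR z)%:E)%E \is a fin_num.
  have := finV (expR x) (expR_ge0 x); rewrite marginalisation_gaussian2//.
  by under eq_integral do rewrite FE.
have [] := subgradient_of_integral Gmono Pi0.
- move=> x; apply: integrable_of_fin_num => //; exact: measurable_mul_expR.
- move=> x; rewrite /marginalisation marginalisation_gaussian2//.
  by rewrite /Rintegral; congr fine; apply: eq_integral => z _; rewrite FE.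
by [].
Qed.

Lemma marginalisation_of_subgradient U V G : U 0 = 0 -> continuous_at0 U -> subgradient U G ->
  V 0 = 0 -> (forall u, 0 < u -> V u = u * G (a * u)) ->
  energy_density V /\ forall r, 0 <= r -> PiE V r = (U r)%:E.
Proof.
move=> U0 cU UG V0 VE.
have Gmono := subgradient_nondecreasing UG.
have mV : measurable_fun (`[0, +oo[%classic : set R) V.
  (* [G] is monotone on positive reals only, so [u] is written as [expR (ln u)]. At [u = 0] the
     outer factor cancels the default value of [ln]. *)
  have mg : measurable_fun setT (fun u : R => u * G (a * expR (ln u))).
    apply: measurable_funM => //.
    apply: (@measurable_comp _ _ _ _ _ _ setT (fun x => G (a * expR x)) _ (@ln R)) => //.
    apply: nondecreasing_measurable => // x y xy; apply: Gmono.
        by rewrite mulr_gt0 ?expR_gt0.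
      by rewrite ler_pM2l// ler_expR.
  apply: (eq_measurable_fun _ _ (measurable_funTS mg)) => u.
  rewrite inE/= in_itv/= andbT le_eqVlt => /predU1P[<-|u0]; first by rewrite mul0r V0.
  by rewrite VE// lnK.
split => // r; rewrite le_eqVlt => /predU1P[<-|r0].
  by rewrite marginalisation_ereal_at0// U0.
rewrite -(lnK r0) marginalisation_gaussian2// -(integral_of_subgradient Gmono (ln r) U0 cU UG).
apply: eq_integral => z _; congr EFin.
have e : a * (expR z / a) = expR z by rewrite mulrC divfK// gt_eqF.
by rewrite VE ?divr_gt0 ?expR_gt0// e (mulrA a) e mulrC.
Qed.

(** With [G] identified as the right derivative, the pressure of [Pi V] is [a * V (u / a) - Pi V u];
    its derivative with respect to [ln u] is [a] times the pressure of [V] at [u / a]. *)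
Lemma marginalisation_pressure_Delta V cs c x : energy_density V ->
  convex_function (`[0, +oo[%classic : set R) V ->
  finite_valued (lebesgue_measure2 R) (gaussian2 s) V ->
  all (>= 1) cs -> 1 <= c -> 0 < x ->
  (forall x, 0 < x -> 0 <= iter_Delta cs (pressure V) x) ->
  0 <= iter_Delta (c :: cs) (pressure (Pi V)) x.
Proof.
move=> eV cV finV cs1 c1 x0 H; have [_ V0] := eV.
have ratio u v : 0 < u -> u <= v -> V u / u <= V v / v by exact: convex_ratio.
have [_ _ UG] := marginalisation_subgradient eV ratio finV.
have Wm := subgradient_dilation a0 (convex_subgradient cV).
have dU u : 0 < u -> right_derivative (Pi V) u = a * V (u / a) / u.
  move=> u0; apply: (subgradient_right_derivative UG u0).
  apply: (subgradient_quotient_cvg Wm u0) => y z [y0 yz].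
  exact: subgradient_nondecreasing UG y0 yz.
have PU u : 0 < u -> pressure (Pi V) u = a * V (u / a) - Pi V u.
  by move=> u0; rewrite /pressure gt_eqF// dU// mulrC divfK// gt_eqF.
apply: (@iter_Delta_log_derivative _ _ (fun u => a * pressure V (a^-1 * u))) => //; last first.
  move=> u u0; rewrite iter_Delta_scale mulr_ge0 ?(ltW a0)//.
  by apply: H; rewrite mulr_gt0// invr_gt0.
have PV u : 0 < u -> a * pressure V (a^-1 * u) =
    u * right_derivative V (u / a) - a * V (u / a).
  move=> u0; rewrite (mulrC _ u) /pressure gt_eqF ?divr_gt0//.
  by rewrite mulrBr mulrA (mulrC a) divfK// gt_eqF.
move=> u v u0 uv; have v0 := lt_le_trans u0 uv.
by rewrite !PV// !PU//; exact: (log_derivative_bounds Wm UG u0 uv).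
Qed.

Lemma marginalisation_codomain j V : gaussian_domain s j V ->
  gaussian_codomain j (Pi V) /\ continuous_at0 V.
Proof.
move=> [Vj finV]; have [eV ratio] := pressure_class_ratio Vj; have [_ V0] := eV.
have [U0 cU UG] := marginalisation_subgradient eV ratio finV.
have convU := subgradient_convex UG.
split; last first.
  apply/(continuous_at0P V0) => e e0.
  (* At the point [a * r] the weight is exactly [a * V r]. *)
  have [d d0 Hd] := subgradient_weight_vanishes U0 cU UG (mulr_gt0 a0 e0).
  exists (d / a); first by rewrite divr_gt0.
  move=> r; rewrite le_eqVlt => /predU1P[<-|r0] rd; first by rewrite V0 normr0 ltW.
  have ar0 : 0 < a * r by rewrite mulr_gt0.
  have := Hd (a * r) ar0; rewrite -ltr_pdivlMl// mulrC => /(_ rd).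
  rewrite mulrC divfK ?gt_eqF// (mulrC a r) mulfK ?gt_eqF// normrM.
  by rewrite (gtr0_norm a0) ler_pM2l.
split => //; apply/pressure_classSP; split => //.
  by split => //; exact: convex_measurable.
move=> [//|c cs] x /eqP; rewrite /= eqSS => /eqP scs /andP[c1 cs1] x0.
(* For [j = 0] only the difference by [c] remains, and the pressure of a convex function is
   nondecreasing. *)
case: j => [|j] in Vj scs *.
  by case: cs scs {cs1} => // _; exact: convex_pressure_Delta.
have [_ cV HV] := (pressure_classSP _ _).1 Vj.
by apply: marginalisation_pressure_Delta => // u u0; exact: HV.
Qed.

Lemma marginalisation_surjective j U : gaussian_codomain j U ->
  exists2 V, gaussian_domain s j V & eq_nonneg (Pi V) U.
Proof.
move=> [/pressure_classSP[[mU U0] convU HU] cU].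
have UG := convex_subgradient convU; set G := right_derivative U in UG.
(* This solves [r * G r = a * V (r / a)] for positive [r]. *)
pose V u := if 0 < u then u * G (a * u) else 0.
have V0 : V 0 = 0 by rewrite /V ltxx.
have VE u : 0 < u -> V u = u * G (a * u) by rewrite /V => ->.
have [eV PV] := marginalisation_of_subgradient U0 cU UG V0 VE.
exists V; last by move=> r; rewrite in_itv/= andbT => r0; rewrite /marginalisation PV.
split; last by move=> r r0; rewrite PV.
case: j => [|j] in HU *.
  split => // x y; rewrite !in_itv/= !andbT => x0 y0 xy.
  rewrite !VE// mulrC mulKf ?gt_eqF// [leRHS]mulrC mulKf ?gt_eqF//.
  by apply: (subgradient_nondecreasing UG); [exact: mulr_gt0|rewrite ler_pM2l].
have P0 := pressure_vanishes convU U0 cU.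
(* The differences of order [j.+2] descend to order two, which is the input for convexity of [V]. *)
have convV : convex_function (`[0, +oo[%classic : set R) V.
  have H2 c d x : 1 <= c -> 1 <= d -> 0 < x ->
      0 <= iter_Delta [:: c; d] (fun x => x * G x - U x) x.
    move=> c1 d1 x0; have cd1 : all (>= 1) [:: c; d] by rewrite /= c1 d1.
    rewrite (@eq_iter_Delta _ _ (pressure U))//; last first.
      by move=> u u0; rewrite /pressure gt_eqF.
    exact: (@iter_Delta_descend _ _ j.+2 2 P0 _ HU).
  have [Q [Q0 HQ]] := reciprocal_subgradient UG H2.
  exact: convex_of_reciprocal_subgradient a0 V0 VE Q0 HQ.
apply/pressure_classSP; split => // cs x scs cs1 x0.
apply: (iter_Delta_pressure_dilation a0 x0 convU convV VE cs1) => c u c1 u0.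
by apply: HU; rewrite //= ?scs// c1.
Qed.

End gaussian.

Theorem theorem1p5 (R : realType) (s : R) (hs : 0 < s) (j : nat) :
  [/\ set_fun (gaussian_domain s j) (gaussian_codomain j)
        (marginalisation (lebesgue_measure2 R) (gaussian2 s)),
      (forall U : R -> R, gaussian_codomain j U ->
         exists2 V : R -> R, gaussian_domain s j V
         & eq_nonneg (marginalisation (lebesgue_measure2 R) (gaussian2 s) V) U)
    & forall V : R -> R, gaussian_domain s j V -> continuous_at0 V].
Proof.
split.
- by move=> V /(marginalisation_codomain hs)[].
- by move=> U; exact: marginalisation_surjective.
- by move=> V /(marginalisation_codomain hs)[].
Qed.
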